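(* Let $M$ be an $\tilde S_2$-module whose restriction to $U(\mathfrak h_2)$ is a free $U(\mathfrak h_2)$-module of rank $1$, and on which the derived subalgebra $\tilde S_2'$ acts nontrivially. Then there exist $\lambda_1,\lambda_2\in\mathbb C^*$ and $\alpha_1,\alpha_2\in\mathbb C$ such that $M\cong\Omega(\lambda_1,\lambda_2,\alpha_1,\alpha_2)$ as $\tilde S_2$-modules.
   Context: All vector spaces and algebras are over $\mathbb C$; $\mathbb C^*=\mathbb C\setminus\{0\}$; $U(\mathfrak a)$ denotes the universal enveloping algebra of a Lie algebra $\mathfrak a$. Let $\mathcal A_2=\mathbb C[t_1^{\pm1},t_2^{\pm1}]$, $\partial_i=t_i\frac{\partial}{\partial t_i}$, $t^r=t_1^{r_1}t_2^{r_2}$ for $r=(r_1,r_2)\in\mathbb Z^2$. The Witt algebra is $\mathcal W_2=\mathrm{Der}(\mathcal A_2)=\mathcal A_2\partial_1\oplus\mathcal A_2\partial_2$ with bracket $[t^r\partial_i,t^s\partial_j]=s_it^{r+s}\partial_j-r_jt^{r+s}\partial_i$. The Lie algebra of divergence-zero vector fields is the subalgebra $\tilde S_2=\{f_1\partial_1+f_2\partial_2: f_i\in\mathcal A_2,\ \partial_1(f_1)+\partial_2(f_2)=0\}=\mathrm{Span}_{\mathbb C}\{\partial_1,\partial_2,\ r_2t^r\partial_1-r_1t^r\partial_2 : r\in\mathbb Z^2\}$, with derived subalgebra $\tilde S_2'=\mathrm{Span}_{\mathbb C}\{r_2t^r\partial_1-r_1t^r\partial_2: r\in\mathbb Z^2\}$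 and Cartan subalgebra $\mathfrak h_2=\mathbb C\partial_1\oplus\mathbb C\partial_2$. For $\lambda_1,\lambda_2\in\mathbb C^*$, $\alpha_1,\alpha_2\in\mathbb C$, the $\tilde S_2$-module $\Omega(\lambda_1,\lambda_2,\alpha_1,\alpha_2)$ is the vector space $\mathbb C[\partial_1,\partial_2]$ on which $\partial_1,\partial_2$ act by multiplication and $$(r_2t^r\partial_1-r_1t^r\partial_2)\cdot f(\partial_1,\partial_2)=\lambda_1^{r_1}\lambda_2^{r_2}\bigl(r_2(\partial_1+\alpha_1)-r_1(\partial_2+\alpha_2)\bigr)f(\partial_1-r_1,\partial_2-r_2).$$ *)

(* Defs.v *)
From HB Require Import structures.
From mathcomp Require Import all_boot all_order all_algebra.
From mathcomp Require Import ring.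
From mathcomp.finmap Require Import finmap.
From mathcomp.multinomials Require Import ssrcomplements mpoly.

Set Implicit Arguments.
Unset Strict Implicit.
Unset Printing Implicit Defensive.

Import GRing.Theory.
Local Open Scope ring_scope.

HB.mixin Record isLieAlgebra (F : fieldType) L of GRing.Lmodule F L := {
  lie : L -> L -> L;
  lie_linear_l : forall (a : F) (x y z : L),
    lie (a *: x + y) z = a *: lie x z + lie y z;
  lie_linear_r : forall (a : F) (x y z : L),
    lie z (a *: x + y) = a *: lie z x + lie z y;
  lie_alt : forall x : L, lie x x = 0;
  lie_jacobi : forall x y z : L,
    lie x (lie y z) + lie y (lie z x) + lie z (lie x y) = 0
}.

#[short(type="lieAlgType")]
HB.structure Definition LieAlgebra (F : fieldType) :=
  {L of GRing.Lmodule F L & isLieAlgebra F L}.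

HB.mixin Record isLieModule (F : fieldType) (L : lieAlgType F) V
    of GRing.Lmodule F V := {
  lact : L -> V -> V;
  lact_linear_l : forall (a : F) (x y : L) (v : V),
    lact (a *: x + y) v = a *: lact x v + lact y v;
  lact_linear_r : forall (a : F) (x : L) (u v : V),
    lact x (a *: u + v) = a *: lact x u + lact x v;
  lact_lie : forall (x y : L) (v : V),
    lact (lie x y) v = lact x (lact y v) - lact y (lact x v)
}.

#[short(type="lieModType")]
HB.structure Definition LieModule (F : fieldType) (L : lieAlgType F) :=
  {V of GRing.Lmodule F V & isLieModule F L V}.

Section LieTheory.
Variables (F : fieldType) (L : lieAlgType F).
Implicit Types x y z : L.

Lemma lieDl x y z : lie (x + y) z = lie x z + lie y z.
Proof. by have := lie_linear_l 1 x y z; rewrite !scale1r. Qed.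
Lemma lieDr x y z : lie z (x + y) = lie z x + lie z y.
Proof. by have := lie_linear_r 1 x y z; rewrite !scale1r. Qed.
Lemma lie0l x : lie 0 x = 0.
Proof. by apply: (addrI (lie 0 x)); rewrite -lieDl !addr0. Qed.
Lemma lie0r x : lie x 0 = 0.
Proof. by apply: (addrI (lie x 0)); rewrite -lieDr !addr0. Qed.
Lemma lieZl a x y : lie (a *: x) y = a *: lie x y.
Proof. by rewrite -[a *: x]addr0 lie_linear_l lie0l addr0. Qed.
Lemma lieZr a x y : lie y (a *: x) = a *: lie y x.
Proof. by rewrite -[a *: x]addr0 lie_linear_r lie0r addr0. Qed.
Lemma lie_anti x y : lie x y = - lie y x.
Proof.
have := lie_alt (x + y); rewrite lieDl !lieDr !lie_alt add0r addr0 => /eqP.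
by rewrite addr_eq0 => /eqP.
Qed.
End LieTheory.

Section LieModTheory.
Variables (F : fieldType) (L : lieAlgType F) (V : lieModType L).
Implicit Types (x y : L) (u v : V).

Lemma lactDl x y v : lact (x + y) v = lact x v + lact y v.
Proof. by have := lact_linear_l 1 x y v; rewrite !scale1r. Qed.
Lemma lactDr x u v : lact x (u + v) = lact x u + lact x v.
Proof. by have := lact_linear_r 1 x u v; rewrite !scale1r. Qed.
Lemma lact0l v : lact (0 : L) v = 0.
Proof. by apply: (addrI (lact (0 : L) v)); rewrite -lactDl !addr0. Qed.
Lemma lact0r x : lact x (0 : V) = 0.
Proof. by apply: (addrI (lact x (0 : V))); rewrite -lactDr !addr0. Qed.
Lemma lactZl a x v : lact (a *: x) v = a *: lact x v.
Proof. by rewrite -[a *: x]addr0 lact_linear_l lact0l addr0. Qed.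
Lemma lactZr a x v : lact x (a *: v) = a *: lact x v.
Proof. by rewrite -[a *: v]addr0 lact_linear_r lact0r addr0. Qed.
End LieModTheory.

Definition lieMod_iso (F : fieldType) (L : lieAlgType F)
    (M N : lieModType L) : Prop :=
  exists f : {linear M -> N},
    bijective f /\ forall (x : L) (m : M), f (lact x m) = lact x (f m).

(* Scalars are absorbed by lie, so this is the linear span of the brackets. *)
Definition in_derived (F : fieldType) (L : lieAlgType F) (x : L) : Prop :=
  exists s : seq (L * L), x = \sum_(p <- s) lie p.1 p.2.

Definition lie_hom (F : fieldType) (L L' : lieAlgType F) (f : L -> L') : Prop :=
  forall x y, f (lie x y) = lie (f x) (f y).

Definition lie_to_assoc (F : fieldType) (L : lieAlgType F) (A : algType F)
    (f : L -> A) : Prop :=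
  forall x y, f (lie x y) = f x * f y - f y * f x.

Definition is_enveloping (F : fieldType) (L : lieAlgType F) (U : algType F)
    (iota : {linear L -> U}) : Prop :=
  lie_to_assoc iota /\
  forall (A : algType F) (phi : {linear L -> A}), lie_to_assoc phi ->
    exists2 psi : {lrmorphism U -> A}, psi \o iota =1 phi &
      forall psi' : {lrmorphism U -> A}, psi' \o iota =1 phi -> psi' =1 psi.

Definition free_of_rank (U : nzRingType) (n : nat) (N : lmodType U) : Prop :=
  exists e : 'I_n -> N, forall m : N,
    exists! c : 'rV[U]_n, m = \sum_(i < n) c 0 i *: e i.

(* The coefficient of t1^i t2^j is the value at (i, j). *)
Record laurent (F : fieldType) := Laurent {
  lval : {fsfun int * int -> F with 0}
}.
HB.instance Definition _ (F : fieldType) := [isNew for @lval F].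
HB.instance Definition _ (F : fieldType) := [Choice of laurent F by <:].

Section Laurent.
Variable F : fieldType.
Local Notation A := (laurent F).
Local Notation Z2 := (int * int)%type.
Implicit Types f g h : A.

Definition lcoef (r : Z2) f : F := lval f r.
Definition lsupp f : {fset Z2} := finsupp (lval f).

Lemma laurentP f g : lcoef^~ f =1 lcoef^~ g -> f = g.
Proof. by move=> eqfg; apply: val_inj; apply/fsfunP. Qed.

Lemma lcoef_out r f : r \notin lsupp f -> lcoef r f = 0.
Proof. exact: fsfun_dflt. Qed.

Definition lmk (d : {fset Z2}) (c : Z2 -> F) : A :=
  Laurent [fsfun r in d => c r | 0].

Lemma lcoef_mk d c r : (r \notin d -> c r = 0) -> lcoef r (lmk d c) = c r.
Proof. by rewrite /lcoef fsfunE; case: ifP => // _ ->. Qed.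

Definition lzero : A := lmk fset0 (fun=> 0).
Definition lopp f := lmk (lsupp f) (fun r => - lcoef r f).
Definition ladd f g :=
  lmk (lsupp f `|` lsupp g)%fset (fun r => lcoef r f + lcoef r g).
Definition lscale (a : F) f := lmk (lsupp f) (fun r => a * lcoef r f).
Definition lmon (r : Z2) : A := lmk [fset r]%fset (fun s => (r == s)%:R).

Lemma lcoef_zero r : lcoef r lzero = 0.
Proof. exact: lcoef_mk. Qed.
Lemma lcoef_opp r f : lcoef r (lopp f) = - lcoef r f.
Proof. by rewrite lcoef_mk // => /lcoef_out ->; rewrite oppr0. Qed.
Lemma lcoef_add r f g : lcoef r (ladd f g) = lcoef r f + lcoef r g.
Proof.
by rewrite lcoef_mk // inE negb_or => /andP[/lcoef_out -> /lcoef_out ->]; rewrite addr0.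
Qed.
Lemma lcoef_scale r a f : lcoef r (lscale a f) = a * lcoef r f.
Proof. by rewrite lcoef_mk // => /lcoef_out ->; rewrite mulr0. Qed.
Lemma lcoef_mon r s : lcoef r (lmon s) = (s == r)%:R.
Proof. by rewrite lcoef_mk // inE eq_sym => /negPf ->. Qed.

Let lcE := (lcoef_zero, lcoef_opp, lcoef_add, lcoef_scale).

Fact laddA : associative ladd.
Proof. by move=> f g h; apply: laurentP => r; rewrite !lcE addrA. Qed.
Fact laddC : commutative ladd.
Proof. by move=> f g; apply: laurentP => r; rewrite !lcE addrC. Qed.
Fact ladd0 : left_id lzero ladd.
Proof. by move=> f; apply: laurentP => r; rewrite !lcE add0r. Qed.
Fact laddN : left_inverse lzero lopp ladd.
Proof. by move=> f; apply: laurentP => r; rewrite !lcE addNr. Qed.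
HB.instance Definition _ := GRing.isZmodule.Build A laddA laddC ladd0 laddN.

Fact lscaleA a b f : lscale a (lscale b f) = lscale (a * b) f.
Proof. by apply: laurentP => r; rewrite !lcE mulrA. Qed.
Fact lscale1 : left_id 1 lscale.
Proof. by move=> f; apply: laurentP => r; rewrite !lcE mul1r. Qed.
Fact lscaleDr : right_distributive lscale +%R.
Proof.
by move=> a f g; apply: laurentP => r; rewrite !(lcoef_scale, lcoef_add) mulrDr.
Qed.
Fact lscaleDl f : {morph lscale^~ f : a b / a + b}.
Proof.
by move=> a b; apply: laurentP => r; rewrite !(lcoef_scale, lcoef_add) mulrDl.
Qed.
HB.instance Definition _ := GRing.Zmodule_isLmodule.Build F A
  lscaleA lscale1 lscaleDr lscaleDl.

Lemma lcoef_is_linear r : linear_for *%R (lcoef r).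
Proof. by move=> a f g; rewrite lcoef_add lcoef_scale. Qed.
HB.instance Definition _ r := GRing.isLinear.Build F A F _ (lcoef r)
  (lcoef_is_linear r).

Lemma lcoef0 r : lcoef r 0 = 0. Proof. exact: linear0. Qed.
Lemma lcoefD r f g : lcoef r (f + g) = lcoef r f + lcoef r g.
Proof. exact: lcoef_add. Qed.
Lemma lcoefZ r a f : lcoef r (a *: f) = a * lcoef r f.
Proof. exact: lcoef_scale. Qed.

Lemma lsupp_mon r : lsupp (lmon r) = [fset r]%fset.
Proof.
apply/fsetP => s; rewrite inE mem_finsupp -/(lcoef s (lmon r)) lcoef_mon.
by case: (eqVneq r s) => _; rewrite ?oner_eq0 ?eqxx.
Qed.

Lemma lmon0_neq0 : lmon 0 != 0.
Proof.
apply/eqP => /(congr1 (lcoef 0)); rewrite lcoef_mon eqxx lcoef0.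
by move/eqP; rewrite oner_eq0.
Qed.
End Laurent.
Arguments lmon {F}.

HB.lock Definition lext (F : fieldType) (V : lmodType F)
    (E : int * int -> V) (f : laurent F) : V :=
  \sum_(r <- lsupp f) lcoef r f *: E r.

Section LaurentRing.
Variable F : fieldType.
Local Notation A := (laurent F).
Local Notation Z2 := (int * int)%type.

Section Lext.
Variables (V : lmodType F) (E : Z2 -> V).

Lemma lextEw (d : {fset Z2}) (f : A) :
  (lsupp f `<=` d)%fset -> lext E f = \sum_(r <- d) lcoef r f *: E r.
Proof.
move=> le; rewrite lext.unlock (big_fset_incl _ le) // => r _ /lcoef_out ->.
by rewrite scale0r.
Qed.

Lemma lext_is_linear : linear (lext E).
Proof.
move=> a f g; pose d := (lsupp (a *: f + g)%R `|` lsupp f `|` lsupp g)%fset.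
rewrite !(@lextEw d) ?fsubsetUr //.
- rewrite scaler_sumr -big_split; apply: eq_bigr => r _ /=.
  by rewrite lcoef_is_linear scalerDl scalerA.
- by rewrite /d -fsetUA fsetUCA fsubsetUl.
- by rewrite /d -fsetUA fsubsetUl.
Qed.

HB.instance Definition _ := GRing.isLinear.Build F A V _ (lext E) lext_is_linear.

Lemma lext0 : lext E 0 = 0. Proof. exact: linear0. Qed.
Lemma lextP a f g : lext E (a *: f + g) = a *: lext E f + lext E g.
Proof. exact: linearP. Qed.

Lemma lext_mon r : lext E (lmon r) = E r.
Proof.
by rewrite lext.unlock lsupp_mon big_seq_fset1 lcoef_mon eqxx scale1r.
Qed.
End Lext.

Lemma laurentE (f : A) : f = lext lmon f.
Proof.
apply: laurentP => k; rewrite lext.unlock linear_sum /=.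
transitivity (\sum_(r <- lsupp f) lcoef r f * (r == k)%:R).
  have [kf|kf] := boolP (k \in lsupp f).
    rewrite (big_fsetD1 k) //= eqxx mulr1 big_seq big1 ?addr0 // => r.
    by rewrite !inE => /andP[/negPf -> _]; rewrite mulr0.
  rewrite lcoef_out // big_seq big1 // => r rf.
  by case: eqP rf kf => [-> ->//|_ _ _]; rewrite mulr0.
by apply: eq_bigr => r _; rewrite lcoefZ lcoef_mon.
Qed.

Lemma laurent_ind (P : A -> Prop) :
  P 0 -> (forall c r g, P g -> P (c *: lmon r + g)) -> forall f, P f.
Proof.
move=> P0 PS f; rewrite (laurentE f) lext.unlock.
by elim/big_rec: _ => // r g _; apply: PS.
Qed.

Lemma lext_eq (V : lmodType F) (E1 E2 : Z2 -> V) :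
  E1 =1 E2 -> lext E1 =1 lext E2.
Proof. by move=> eqE f; rewrite lext.unlock; apply: eq_bigr => r _; rewrite eqE. Qed.

Definition lmul (f g : A) : A := lext (fun r => lext (fun s => lmon (r + s)) g) f.

Lemma lmul_linear_l a f1 f2 g :
  lmul (a *: f1 + f2) g = a *: lmul f1 g + lmul f2 g.
Proof. exact: lextP. Qed.

Lemma lmul_linear_r a f g1 g2 :
  lmul f (a *: g1 + g2) = a *: lmul f g1 + lmul f g2.
Proof.
rewrite /lmul; elim/laurent_ind: f => [|c r f IH]; first by rewrite !lext0 scaler0 addr0.
rewrite !lextP IH !lext_mon lextP !scalerDr !scalerA (mulrC c a).
by rewrite addrACA.
Qed.

Lemma lmul_mon r s : lmul (lmon r) (lmon s) = lmon (r + s).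
Proof. by rewrite /lmul !lext_mon. Qed.

Lemma lmul0l g : lmul 0 g = 0. Proof. exact: lext0. Qed.
Lemma lmul0r f : lmul f 0 = 0.
Proof.
have := lmul_linear_r 1 f 0 0; rewrite !scale1r addr0 => /eqP.
by rewrite -subr_eq0 opprD addNKr oppr_eq0 => /eqP.
Qed.

Lemma lmulC : commutative lmul.
Proof.
move=> f g; elim/laurent_ind: f => [|c r f IH]; first by rewrite lmul0l lmul0r.
rewrite lmul_linear_l lmul_linear_r IH; congr (_ *: _ + _).
elim/laurent_ind: g {IH} => [|d s g IH]; first by rewrite lmul0l lmul0r.
by rewrite lmul_linear_l lmul_linear_r IH !lmul_mon (addrC r s).
Qed.

Lemma lmulA : associative lmul.
Proof.
move=> f g h; elim/laurent_ind: f => [|c r f IH]; first by rewrite !lmul0l.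
rewrite !lmul_linear_l IH; congr (_ *: _ + _).
elim/laurent_ind: g {IH} => [|d s g IH]; first by rewrite lmul0l lmul0r lmul0l.
rewrite lmul_linear_l !lmul_linear_r lmul_linear_l IH; congr (_ *: _ + _).
elim/laurent_ind: h {IH} => [|e t h IH]; first by rewrite !lmul0r.
by rewrite !lmul_linear_r IH !lmul_mon addrA.
Qed.

Lemma lmul1l : left_id (lmon 0) lmul.
Proof.
move=> f; elim/laurent_ind: f => [|c r f IH]; first by rewrite lmul0r.
by rewrite lmul_linear_r IH lmul_mon add0r.
Qed.

Lemma lmulDl : left_distributive lmul +%R.
Proof. by move=> f g h; have := lmul_linear_l 1 f g h; rewrite !scale1r. Qed.

HB.instance Definition _ := GRing.Zmodule_isComNzRing.Build A
  lmulA lmulC lmul1l lmulDl (lmon0_neq0 F).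

Lemma lmonM r s : lmon r * lmon s = lmon (r + s).
Proof. exact: lmul_mon. Qed.

Lemma laurent_scalerAl (a : F) (f g : A) : a *: (f * g) = (a *: f) * g.
Proof. by apply: esym; have := lmul_linear_l a f 0 g; rewrite lmul0l !addr0. Qed.

HB.instance Definition _ := GRing.Lmodule_isLalgebra.Build F A laurent_scalerAl.
HB.instance Definition _ := GRing.Lalgebra_isComAlgebra.Build F A.

(* t_i d/dt_i *)
Definition ld1 : A -> A := lext (fun r => r.1%:~R *: lmon r).
Definition ld2 : A -> A := lext (fun r => r.2%:~R *: lmon r).

Lemma ld1_mon r : ld1 (lmon r) = r.1%:~R *: lmon r.
Proof. exact: lext_mon. Qed.
Lemma ld2_mon r : ld2 (lmon r) = r.2%:~R *: lmon r.
Proof. exact: lext_mon. Qed.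

Lemma ld1P a f g : ld1 (a *: f + g) = a *: ld1 f + ld1 g.
Proof. exact: lextP. Qed.
Lemma ld2P a f g : ld2 (a *: f + g) = a *: ld2 f + ld2 g.
Proof. exact: lextP. Qed.
HB.instance Definition _ := GRing.isLinear.Build F A A _ ld1 ld1P.
HB.instance Definition _ := GRing.isLinear.Build F A A _ ld2 ld2P.
Lemma ld10 : ld1 0 = 0. Proof. exact: lext0. Qed.
Lemma ld20 : ld2 0 = 0. Proof. exact: lext0. Qed.
Lemma ld1D f g : ld1 (f + g) = ld1 f + ld1 g. Proof. exact: raddfD. Qed.
Lemma ld2D f g : ld2 (f + g) = ld2 f + ld2 g. Proof. exact: raddfD. Qed.
Lemma ld1N f : ld1 (- f) = - ld1 f. Proof. exact: raddfN. Qed.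
Lemma ld2N f : ld2 (- f) = - ld2 f. Proof. exact: raddfN. Qed.

Lemma ext_leibniz (k : {additive Z2 -> int}) (d := lext (fun r => (k r)%:~R *: lmon r)) (f g : A) :
  d (f * g) = d f * g + f * d g.
Proof.
elim/laurent_ind: f => [|c r f IH]; first by rewrite !mul0r /d lext0 mul0r addr0.
rewrite mulrDl -scalerAl /d !lextP -/d IH !mulrDl -!scalerAl.
rewrite addrACA -scalerDr; congr (_ *: _ + _).
elim/laurent_ind: g {IH} => [|e s g IH]; first by rewrite !mulr0 /d lext0 mulr0 addr0.
rewrite mulrDr -scalerAr /d !lextP -/d IH !mulrDr -!scalerAr.
rewrite addrACA -scalerDr; congr (_ *: _ + _).
rewrite lmonM /d !lext_mon -scalerAl -scalerAr lmonM -scalerDl raddfD /=.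
by rewrite intrD.
Qed.

Lemma ld1M f g : ld1 (f * g) = ld1 f * g + f * ld1 g.
Proof. exact: (ext_leibniz fst). Qed.

Lemma ld2M f g : ld2 (f * g) = ld2 f * g + f * ld2 g.
Proof. exact: (ext_leibniz snd). Qed.

Lemma ld12C f : ld1 (ld2 f) = ld2 (ld1 f).
Proof.
elim/laurent_ind: f => [|c r f IH]; first by rewrite ld10 ld20 ld10.
rewrite ld1P !ld2P ld1P IH ld1_mon ld2_mon; congr (_ *: _ + _).
rewrite -[_ *: lmon r]addr0 ld1P ld10 -[_ *: lmon r in RHS]addr0 ld2P ld20.
by rewrite !addr0 ld1_mon ld2_mon !scalerA mulrC.
Qed.
End LaurentRing.

(* The pair (f1, f2) stands for the derivation f1 d1 + f2 d2 *)
Definition witt (F : fieldType) := (laurent F * laurent F)%type.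
HB.instance Definition _ (F : fieldType) := GRing.Lmodule.on (witt F).

Section Witt.
Variable F : fieldType.
Local Notation W := (witt F).
Implicit Types x y z : W.

Definition wapp x (g : laurent F) : laurent F := x.1 * ld1 g + x.2 * ld2 g.

Definition wlie x y : W :=
  (wapp x y.1 - wapp y x.1, wapp x y.2 - wapp y x.2).

Lemma wapp_linear_l a x y g : wapp (a *: x + y) g = a *: wapp x g + wapp y g.
Proof.
by rewrite /wapp /= !mulrDl -!scalerAl scalerDr addrACA.
Qed.

Lemma wapp_linear_r a x f g : wapp x (a *: f + g) = a *: wapp x f + wapp x g.
Proof.
by rewrite /wapp ld1P ld2P !mulrDr -!scalerAr scalerDr addrACA.
Qed.

Lemma wlie_alt x : wlie x x = 0.
Proof. by rewrite /wlie !subrr. Qed.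

Lemma wlie_linear_l a x y z : wlie (a *: x + y) z = a *: wlie x z + wlie y z.
Proof.
by rewrite /wlie; apply/pair_equal_spec; split=> /=;
  rewrite wapp_linear_l wapp_linear_r opprD addrACA scalerBr.
Qed.

Lemma wlie_linear_r a x y z : wlie z (a *: x + y) = a *: wlie z x + wlie z y.
Proof.
by rewrite /wlie; apply/pair_equal_spec; split=> /=;
  rewrite wapp_linear_l wapp_linear_r opprD addrACA scalerBr.
Qed.

Lemma wlie_jacobi x y z :
  wlie x (wlie y z) + wlie y (wlie z x) + wlie z (wlie x y) = 0.
Proof.
case: x y z => [x1 x2] [y1 y2] [z1 z2].
rewrite /wlie /wapp; apply/pair_equal_spec; split=> /=;
  rewrite !(ld1N, ld2N, ld1D, ld2D, ld1M, ld2M, ld12C); ring.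
Qed.

HB.instance Definition _ := isLieAlgebra.Build F W
  wlie_linear_l wlie_linear_r wlie_alt wlie_jacobi.

Definition wdiv x : laurent F := ld1 x.1 + ld2 x.2.

Lemma wdiv_is_linear : linear wdiv.
Proof. by move=> a x y; rewrite /wdiv /= ld1P ld2P scalerDr addrACA. Qed.
HB.instance Definition _ := GRing.isLinear.Build F W (laurent F) _ wdiv
  wdiv_is_linear.

Lemma wdiv_lie x y : wdiv (wlie x y) = wapp x (wdiv y) - wapp y (wdiv x).
Proof.
case: x y => [x1 x2] [y1 y2]; rewrite /wdiv /wlie /wapp /=.
rewrite !(ld1N, ld2N, ld1D, ld2D, ld1M, ld2M, ld12C); ring.
Qed.

(* [t^r d_i, t^s d_j] = s_i t^(r+s) d_j - r_j t^(r+s) d_i *)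
Let simp := (ld10, ld20, ld1_mon, ld2_mon, mul0r, mulr0, addr0, add0r, subr0,
  sub0r, subrr, oppr0, lmonM).

Lemma wlie_mon11 r s : lie ((lmon r, 0) : W) (lmon s, 0) =
  (s.1%:~R *: lmon (r + s) - r.1%:~R *: lmon (r + s), 0).
Proof.
apply/pair_equal_spec; split; rewrite /wapp /= !simp //.
by rewrite -!scalerAr !lmonM (addrC s).
Qed.

Lemma wlie_mon12 r s : lie ((lmon r, 0) : W) (0, lmon s) =
  (- (r.2%:~R *: lmon (r + s)), s.1%:~R *: lmon (r + s)).
Proof.
apply/pair_equal_spec; split; rewrite /wapp /= !simp -!scalerAr lmonM //.
by rewrite (addrC s).
Qed.

Lemma wlie_mon22 r s : lie ((0, lmon r) : W) (0, lmon s) =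
  (0, s.2%:~R *: lmon (r + s) - r.2%:~R *: lmon (r + s)).
Proof.
apply/pair_equal_spec; split; rewrite /wapp /= !simp //.
by rewrite -!scalerAr !lmonM (addrC s).
Qed.
End Witt.

Definition divfree_pred (F : fieldType) : pred (witt F) :=
  fun x => wdiv x == 0.

Fact divfree_submod (F : fieldType) : submod_closed (@divfree_pred F).
Proof.
split; first by rewrite unfold_in linear0.
move=> a x y; rewrite !unfold_in => /eqP x0 /eqP y0.
by rewrite linearP /= x0 y0 scaler0 addr0.
Qed.
HB.instance Definition _ (F : fieldType) :=
  GRing.isSubmodClosed.Build F (witt F) (@divfree_pred F) (@divfree_submod F).

Record divfree (F : fieldType) := DivFree {
  dfval :> witt F;
  dfvalP : dfval \in @divfree_pred F
}.

HB.instance Definition _ (F : fieldType) := [isSub for @dfval F].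
HB.instance Definition _ (F : fieldType) := [Choice of divfree F by <:].
HB.instance Definition _ (F : fieldType) :=
  [SubChoice_isSubLmodule of divfree F by <:].

Section DivFree.
Variable F : fieldType.
Local Notation W := (witt F).
Local Notation S := (divfree F).

Lemma dfP (x : S) : wdiv x = 0. Proof. exact/eqP/dfvalP. Qed.

Fact dflie_subproof (x y : S) : lie (x : W) (y : W) \in @divfree_pred F.
Proof.
rewrite unfold_in wdiv_lie !dfP /wapp ld10 ld20 !mulr0 !addr0 subrr.
exact: eqxx.
Qed.
Definition dflie (x y : S) : S := DivFree (dflie_subproof x y).

Fact dflie_linear_l a x y z : dflie (a *: x + y) z = a *: dflie x z + dflie y z.
Proof. by apply: val_inj; apply: lie_linear_l. Qed.
Fact dflie_linear_r a x y z : dflie z (a *: x + y) = a *: dflie z x + dflie z y.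
Proof. by apply: val_inj; apply: lie_linear_r. Qed.
Fact dflie_alt x : dflie x x = 0.
Proof. by apply: val_inj; apply: lie_alt. Qed.
Fact dflie_jacobi x y z :
  dflie x (dflie y z) + dflie y (dflie z x) + dflie z (dflie x y) = 0.
Proof. by apply: val_inj; apply: lie_jacobi. Qed.
HB.instance Definition _ := isLieAlgebra.Build F S
  dflie_linear_l dflie_linear_r dflie_alt dflie_jacobi.

Fact dfd1_subproof : ((1, 0) : W) \in @divfree_pred F.
Proof. by rewrite unfold_in /wdiv /= ld20 ld1_mon scale0r addr0. Qed.
Definition dfd1 : S := DivFree dfd1_subproof.

Fact dfd2_subproof : ((0, 1) : W) \in @divfree_pred F.
Proof. by rewrite unfold_in /wdiv /= ld10 ld2_mon scale0r addr0. Qed.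
Definition dfd2 : S := DivFree dfd2_subproof.

Definition whom (a b : F) (r : int * int) : W := (a *: lmon r, b *: lmon r).

Lemma wdiv_hom a b r :
  wdiv (whom a b r) = (a * r.1%:~R + b * r.2%:~R) *: lmon r.
Proof.
rewrite /wdiv /= -[a *: _]addr0 -[b *: _]addr0 ld1P ld2P ld10 ld20 !addr0.
by rewrite ld1_mon ld2_mon !scalerA scalerDl.
Qed.

(* r_2 t^r d1 - r_1 t^r d2 *)
Fact dfD_subproof r : whom r.2%:~R (- r.1%:~R) r \in @divfree_pred F.
Proof.
rewrite unfold_in wdiv_hom mulNr (mulrC r.1%:~R) subrr scale0r; exact: eqxx.
Qed.
Definition dfD (r : int * int) : S := DivFree (dfD_subproof r).

Lemma lcoef_ld1 r (f : laurent F) : lcoef r (ld1 f) = lcoef r f * r.1%:~R.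
Proof.
elim/laurent_ind: f => [|c s f IH]; first by rewrite ld10 lcoef0 mul0r.
rewrite ld1P !lcoef_is_linear IH ld1_mon lcoefZ lcoef_mon mulrDl; congr (_ + _).
by case: eqP => [->|_]; rewrite ?mulr0 ?mul0r // !mulr1.
Qed.

Lemma lcoef_ld2 r (f : laurent F) : lcoef r (ld2 f) = lcoef r f * r.2%:~R.
Proof.
elim/laurent_ind: f => [|c s f IH]; first by rewrite ld20 lcoef0 mul0r.
rewrite ld2P !lcoef_is_linear IH ld2_mon lcoefZ lcoef_mon mulrDl; congr (_ + _).
by case: eqP => [->|_]; rewrite ?mulr0 ?mul0r // !mulr1.
Qed.

Lemma whom_sum (x : W) : x =
  \sum_(r <- (lsupp x.1 `|` lsupp x.2)%fset) whom (lcoef r x.1) (lcoef r x.2) r.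
Proof.
case: x => f g /=; set d := (_ `|` _)%fset.
have -> : forall s : seq (int * int), \sum_(r <- s) whom (lcoef r f) (lcoef r g) r
   = (\sum_(r <- s) lcoef r f *: lmon r, \sum_(r <- s) lcoef r g *: lmon r) :> W.
  by elim=> [|r s IH]; rewrite ?big_nil // !big_cons IH.
by rewrite -!lextEw ?fsubsetUl ?fsubsetUr // -!laurentE.
Qed.

Lemma divfree_ind (P : W -> Prop) :
  P 0 -> (forall x y, P x -> P y -> P (x + y)) ->
  (forall a b r, a * r.1%:~R + b * r.2%:~R = 0 -> P (whom a b r)) ->
  forall x : S, P x.
Proof.
move=> P0 PD PH x; rewrite (whom_sum x); elim/big_ind: _ => // r _.
apply: PH; have /(congr1 (lcoef r)) := dfP x.
by rewrite /wdiv lcoefD lcoef_ld1 lcoef_ld2 lcoef0.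
Qed.

End DivFree.
(* The abelian Lie algebra h_2: (a, b) stands for a d1 + b d2. *)
Definition cartan (F : fieldType) := (F^o * F^o)%type.
HB.instance Definition _ (F : fieldType) := GRing.Lmodule.on (cartan F).

Section CartanLie.
Variable F : fieldType.
Implicit Types h k : cartan F.

Definition cartan_lie h k : cartan F := 0.
Fact cartan_lie_linear_l a h k l :
  cartan_lie (a *: h + k) l = a *: cartan_lie h l + cartan_lie k l.
Proof. by rewrite /cartan_lie scaler0 addr0. Qed.
Fact cartan_lie_linear_r a h k l :
  cartan_lie l (a *: h + k) = a *: cartan_lie l h + cartan_lie l k.
Proof. by rewrite /cartan_lie scaler0 addr0. Qed.
Fact cartan_lie_alt h : cartan_lie h h = 0. Proof. by []. Qed.
Fact cartan_lie_jacobi h k l : cartan_lie h (cartan_lie k l) +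
  cartan_lie k (cartan_lie l h) + cartan_lie l (cartan_lie h k) = 0.
Proof. by rewrite /cartan_lie !addr0. Qed.
HB.instance Definition _ := isLieAlgebra.Build F (cartan F)
  cartan_lie_linear_l cartan_lie_linear_r cartan_lie_alt cartan_lie_jacobi.

Definition cartan_emb h : divfree F := (h.1 : F) *: dfd1 F + (h.2 : F) *: dfd2 F.

Lemma lie_dfd12 : lie (dfd1 F) (dfd2 F) = 0.
Proof.
apply: val_inj; apply/pair_equal_spec.
have l1 : ld1 (1 : laurent F) = 0 by rewrite ld1_mon scale0r.
have l2 : ld2 (1 : laurent F) = 0 by rewrite ld2_mon scale0r.
by split; rewrite /wapp /= ?l1 ?l2 ?ld10 ?ld20 !(mulr0, addr0, subr0).
Qed.

Lemma cartan_emb_inj : injective cartan_emb.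
Proof.
move=> [a b] [c d] /(congr1 val)/pair_equal_spec /=.
rewrite !scaler0 !addr0 !add0r => -[/(congr1 (lcoef 0)) + /(congr1 (lcoef 0))].
by rewrite !lcoefZ !lcoef_mon eqxx !mulr1 => -> ->.
Qed.

Lemma cartan_emb_lie : lie_hom cartan_emb.
Proof.
move=> h k; rewrite [LHS]/cartan_emb !scale0r addr0 /cartan_emb.
rewrite lieDl !lieDr !lieZl !lieZr !lie_alt lie_dfd12 lie_anti lie_dfd12.
by rewrite oppr0 !scaler0 !addr0.
Qed.
End CartanLie.

Local Notation X1 := ('X_ord0).
Local Notation X2 := ('X_ord_max).

Section Envelope.
Variable F : fieldType.
Local Notation P := {mpoly F[2]}.
Implicit Types (p q : P) (m : 'X_{1..2}).

Definition cartanU (h : cartan F) : P := (h.1 : F) *: X1 + (h.2 : F) *: X2.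

Fact cartanU_is_linear : linear cartanU.
Proof.
by move=> a h k; rewrite /cartanU /= !scalerDl scalerDr !scalerA addrACA.
Qed.
HB.instance Definition _ := GRing.isLinear.Build F (cartan F) P _ cartanU
  cartanU_is_linear.

Section Mext.
Variables (V : lmodType F) (E : 'X_{1..2} -> V).
Definition mext p : V := \sum_(m <- msupp p) p@_m *: E m.

Lemma mextEw p k : (msize p <= k)%N ->
  mext p = \sum_(m : 'X_{1..2 < k}) p@_m *: E m.
Proof.
move=> lepk; pose I : subFinType _ := 'X_{1..2 < k}.
rewrite /mext (big_mksub I) ?msupp_uniq //=; first last.
  by move=> m /msize_mdeg_lt /leq_trans; apply.
by rewrite big_rmcond //= => m /memN_msupp_eq0 ->; rewrite scale0r.
Qed.

Fact mext_is_linear : linear mext.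
Proof.
move=> a p q; pose k := maxn (msize (a *: p + q)) (maxn (msize p) (msize q)).
rewrite !(@mextEw _ k) ?leq_max ?leqnn ?orbT // scaler_sumr -big_split.
by apply: eq_bigr => m _ /=; rewrite mcoeffD mcoeffZ scalerDl scalerA.
Qed.
HB.instance Definition _ := GRing.isLinear.Build F P V _ mext mext_is_linear.

Lemma mextP a p q : mext (a *: p + q) = a *: mext p + mext q.
Proof. exact: mext_is_linear. Qed.
Lemma mext0 : mext 0 = 0. Proof. exact: linear0. Qed.
Lemma mextX m : mext 'X_[m] = E m.
Proof. by rewrite /mext msuppX big_seq1 mcoeffX eqxx scale1r. Qed.
End Mext.

Lemma mpoly2_ind (Q : P -> Prop) :
  Q 0 -> (forall c m p, Q p -> Q (c *: 'X_[m] + p)) -> forall p, Q p.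
Proof. by move=> Q0 QS; elim/mpolyind=> // c m p _ _; apply: QS. Qed.

Lemma mpolyX2 m : 'X_[m] = X1 ^+ m ord0 * X2 ^+ m ord_max :> P.
Proof.
rewrite mpolyXE_id 2!big_ord_recl big_ord0 mulr1.
by rewrite (_ : lift ord0 ord0 = ord_max) //; apply: val_inj.
Qed.

Lemma lrmorph_mpoly2 (A : algType F) (f g : {lrmorphism P -> A}) :
  f X1 = g X1 -> f X2 = g X2 -> f =1 g.
Proof.
have hP (h : {lrmorphism P -> A}) c p q : h (c *: p + q) = c *: h p + h q.
  exact: linearP.
move=> e1 e2 p; elim/mpoly2_ind: p => [|c m p IH]; first by rewrite !raddf0.
by rewrite !hP IH mpolyX2 !rmorphM !rmorphXn /= e1 e2.
Qed.

Lemma cartanU_enveloping : is_enveloping cartanU.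
Proof.
split=> [h k|A phi phiL]; first by rewrite linear0 mulrC subrr.
pose u1 := phi (1, 0); pose u2 := phi (0, 1).
have u12 : u1 * u2 = u2 * u1.
  by apply/eqP; rewrite -subr_eq0 -phiL linear0.
pose E m := u1 ^+ m ord0 * u2 ^+ m ord_max.
have ED m1 m2 : E (m1 + m2)%MM = E m1 * E m2.
  rewrite /E !mnmDE !exprD -!mulrA; congr (_ * _); rewrite !mulrA; congr (_ * _).
  by apply: commrX; apply: commr_sym; apply: commrX.
have E0 : E 0%MM = 1 by rewrite /E !mnm0E !expr0 mulr1.
have mextM : monoid_morphism (mext E).
  split=> [|p q]; first by rewrite -mpolyX0 mextX E0.
  elim/mpoly2_ind: p => [|c m p IH]; first by rewrite !mul0r mext0 mul0r.
  rewrite mulrDl -scalerAl !mextP IH mulrDl -scalerAl; congr (_ *: _ + _).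
  elim/mpoly2_ind: q {IH} => [|d n q IH]; first by rewrite !mulr0 mext0 mulr0.
  rewrite mulrDr -scalerAr !mextP IH mulrDr -scalerAr; congr (_ *: _ + _).
  by rewrite -mpolyXD !mextX ED.
pose Mm := GRing.isMonoidMorphism.Build P A (mext E) mextM.
pose Lf := HB.pack_for {lrmorphism P -> A} (mext E) Mm.
have phiE h : phi h = (h.1 : F) *: u1 + (h.2 : F) *: u2.
  rewrite -!linearZ -linearD; congr (phi _).
  by case: h => a b; apply/pair_equal_spec; split; rewrite /= ?scaler0 ?addr0 ?add0r /GRing.scale /= mulr1.
have psiE (f : {lrmorphism P -> A}) : f \o cartanU =1 phi <-> f X1 = u1 /\ f X2 = u2.
  split=> [fE|[f1 f2] h].
    by rewrite /u1 /u2 -!fE /= /cartanU /= !scale1r !scale0r addr0 add0r.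
  by rewrite /= /cartanU linearD !linearZ /= f1 f2 phiE.
exists Lf.
  apply/psiE; split; rewrite /Lf /= mextX /E !mnm1E //=.
  - by rewrite expr1 expr0 mulr1.
  - by rewrite expr1 expr0 mul1r.
move=> f /psiE[f1 f2]; apply: lrmorph_mpoly2; rewrite ?f1 ?f2.
- by rewrite /Lf /= mextX /E !mnm1E /= expr1 expr0 mulr1.
- by rewrite /Lf /= mextX /E !mnm1E /= expr1 expr0 mul1r.
Qed.
End Envelope.
(* The type M seen as a module over U(h_2) = {mpoly F[2]}, whose two variables
   act as d1 and d2; see cartanU_enveloping and cartanU_resU. *)
Definition resU (F : fieldType) (M : lieModType (divfree F)) : Type := M.

Section ResU.
Variables (F : fieldType) (M : lieModType (divfree F)).
Local Notation P := {mpoly F[2]}.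
HB.instance Definition _ := GRing.Zmodule.on (resU M).

Definition uact (p : P) (v : resU M) : resU M :=
  mext (fun m => iter (m ord0) (lact (dfd1 F))
                   (iter (m ord_max) (lact (dfd2 F)) (v : M))) p.

Local Notation D1 := (lact (dfd1 F) : M -> M).
Local Notation D2 := (lact (dfd2 F) : M -> M).

Lemma lact_dfd12 (v : M) : D1 (D2 v) = D2 (D1 v).
Proof.
by apply/eqP; rewrite -subr_eq0 -lact_lie lie_dfd12 lact0l.
Qed.

Lemma iter_linear (x : divfree F) n a (u v : M) :
  iter n (lact x) (a *: u + v) = a *: iter n (lact x) u + iter n (lact x) v.
Proof. by elim: n => //= n ->; rewrite lact_linear_r. Qed.

Lemma uact_linear_l a p q v : uact (a *: p + q) v = a *: (uact p v : M) + uact q v.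
Proof. exact: mextP. Qed.

Lemma uact0l v : uact 0 v = 0. Proof. exact: mext0. Qed.

Lemma uactX m v : uact 'X_[m] v = iter (m ord0) D1 (iter (m ord_max) D2 v).
Proof. exact: mextX. Qed.

Lemma uact_linear_r p a (u v : M) :
  uact p (a *: u + v) = a *: (uact p u : M) + uact p v.
Proof.
elim/mpoly2_ind: p => [|c m p IH]; first by rewrite !uact0l scaler0 addr0.
rewrite !uact_linear_l IH !uactX !iter_linear !scalerDr !scalerA (mulrC c).
by rewrite addrACA.
Qed.

Lemma uact0r p : uact p 0 = 0.
Proof.
by have /eqP := uact_linear_r p 1 0 0; rewrite !scale1r addr0 -subr_eq0 opprD addNKr oppr_eq0 => /eqP.
Qed.

Fact uactA p q v : uact p (uact q v) = uact (p * q) v.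
Proof.
elim/mpoly2_ind: p => [|c m p IH]; first by rewrite mul0r !uact0l.
rewrite mulrDl -scalerAl !uact_linear_l IH; congr (_ *: _ + _).
elim/mpoly2_ind: q {IH} => [|d n q IH]; first by rewrite mulr0 !uact0l uact0r.
rewrite mulrDr -scalerAr !uact_linear_l uact_linear_r IH; congr (_ *: _ + _).
rewrite -mpolyXD !uactX !mnmDE !iterD; congr (iter _ _ _).
elim: (m ord_max) => //= k ->.
by elim: (n ord0) => //= l <-; rewrite lact_dfd12.
Qed.

Fact uact1 : left_id 1 uact.
Proof. by move=> v; rewrite -mpolyX0 uactX !mnm0E. Qed.

Fact uactDr : right_distributive uact +%R.
Proof. by move=> p u v; have := uact_linear_r p 1 u v; rewrite !scale1r. Qed.

Fact uactDl v : {morph uact^~ v : p q / p + q}.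
Proof. by move=> p q; have := uact_linear_l 1 p q v; rewrite !scale1r. Qed.

HB.instance Definition _ := GRing.Zmodule_isLmodule.Build P (resU M)
  uactA uact1 uactDr uactDl.

Lemma cartanU_resU (h : cartan F) (v : resU M) :
  cartanU h *: v = (lact (cartan_emb h) (v : M) : resU M).
Proof.
have E (a b : F) : uact (a *: X1 + b *: X2) v = a *: D1 v + b *: D2 v.
  rewrite uact_linear_l -[_ *: X2]addr0 uact_linear_l uact0l addr0.
  by rewrite !uactX !mnm1E /=.
by rewrite /cartan_emb lactDl !lactZl; apply: E.
Qed.
End ResU.

Definition nonzero (F : fieldType) := {l : F | l != 0}.

Definition Omega (F : fieldType) (l1 l2 : nonzero F) (a1 a2 : F) : Type :=
  {mpoly F[2]}.

(* f(d1 - r_1, d2 - r_2) *)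
HB.lock Definition pshift (F : fieldType) (r : int * int) (f : {mpoly F[2]}) :
    {mpoly F[2]} :=
  f \mPo [tuple X1 - (r.1%:~R)%:MP; X2 - (r.2%:~R)%:MP].

Section Omega.
Variables (F : fieldType) (l1 l2 : nonzero F) (a1 a2 : F).
Local Notation P := {mpoly F[2]}.
Local Notation Z2 := (int * int)%type.
Local Notation W := (witt F).
Implicit Types (f g : P) (r s : Z2).
HB.instance Definition _ := GRing.Lmodule.on (Omega l1 l2 a1 a2).

Definition lpow r : F := sval l1 ^ r.1 * sval l2 ^ r.2.

(* The scalars a1 and a2 only occur for r != 0: d_i acts by multiplication. *)
Definition ofactor (c d : F) r : P :=
  c *: (X1 + (a1 *+ (r != 0))%:MP) + d *: (X2 + (a2 *+ (r != 0))%:MP).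

(* Action of (c d1 + d d2) t^r, extended linearly. *)
Definition ohom c d r f : P := lpow r *: (ofactor c d r * pshift r f).
Definition owact (x : W) f : P :=
  lext (fun r => ohom 1 0 r f) x.1 + lext (fun r => ohom 0 1 r f) x.2.

Lemma ohom_split c d r f : ohom c d r f = c *: ohom 1 0 r f + d *: ohom 0 1 r f.
Proof.
rewrite /ohom /ofactor !scale1r !scale0r addr0 add0r mulrDl -!scalerAl.
by rewrite scalerDr !scalerA !(mulrC (lpow r)).
Qed.

Lemma owact_hom c d r f : owact (whom c d r) f = ohom c d r f.
Proof.
rewrite /owact /= -[c *: _]addr0 -[d *: _]addr0 !lextP !lext0 !addr0 !lext_mon.
by rewrite -ohom_split.
Qed.

Lemma owact_linear_l a x y f : owact (a *: x + y) f = a *: owact x f + owact y f.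
Proof. by rewrite /owact /= !lextP scalerDr addrACA. Qed.

Lemma pshiftP r a f g : pshift r (a *: f + g) = a *: pshift r f + pshift r g.
Proof. by rewrite pshift.unlock linearP. Qed.
Lemma pshiftM r f g : pshift r (f * g) = pshift r f * pshift r g.
Proof. by rewrite pshift.unlock rmorphM. Qed.

Lemma ohomP c d r a f g : ohom c d r (a *: f + g) = a *: ohom c d r f + ohom c d r g.
Proof.
by rewrite /ohom pshiftP mulrDr -scalerAr scalerDr !scalerA mulrC.
Qed.

Lemma lext_linear_r (E : P -> Z2 -> P) (x : laurent F) a f g :
  (forall r, E (a *: f + g) r = a *: E f r + E g r) ->
  lext (E (a *: f + g)) x = a *: lext (E f) x + lext (E g) x.
Proof.
move=> EP; rewrite (lext_eq EP).
elim/laurent_ind: x => [|c r x IH]; first by rewrite !lext0 scaler0 addr0.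
rewrite !lextP IH !lext_mon !scalerDr !scalerA (mulrC c).
by rewrite addrACA.
Qed.

Lemma owact_linear_r x a f g : owact x (a *: f + g) = a *: owact x f + owact x g.
Proof.
have e1 := @lext_linear_r (fun h r => ohom 1 0 r h) x.1 a f g
  (fun r => ohomP 1 0 r a f g).
have e2 := @lext_linear_r (fun h r => ohom 0 1 r h) x.2 a f g
  (fun r => ohomP 0 1 r a f g).
apply: etrans (f_equal2 +%R e1 e2) _.
by rewrite /owact scalerDr addrACA.
Qed.

Lemma pshift_shift r s f : pshift r (pshift s f) = pshift (r + s) f.
Proof.
have hP t (a : F) p q : pshift t (a *: p + q) = a *: pshift t p + pshift t q.
  exact: pshiftP.
have h0 t : pshift t 0 = 0 by rewrite pshift.unlock raddf0.
elim/mpoly2_ind: f => [|c m f IH]; first by rewrite !h0.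
rewrite (hP s) (hP r) (hP (r + s)) IH; congr (_ *: _ + _).
rewrite mpolyX2 (pshiftM s) (pshiftM r) (pshiftM (r + s)); congr (_ * _).
  rewrite pshift.unlock !rmorphXn /= !comp_mpolyXU /= linearB /= comp_mpolyC.
  by rewrite comp_mpolyXU /= intrD mpolyCD opprD addrA.
rewrite pshift.unlock !rmorphXn /= !comp_mpolyXU /= linearB /= comp_mpolyC.
by rewrite comp_mpolyXU /= intrD mpolyCD opprD addrA.
Qed.

Lemma pshift_factor r c d s :
  pshift r (ofactor c d s) = ofactor c d s - (c * r.1%:~R + d * r.2%:~R)%:MP.
Proof.
rewrite pshift.unlock /ofactor linearD !linearZ /= !linearD /= !comp_mpolyXU /=.
rewrite !comp_mpolyC mpolyCD !mpolyCM -!mul_mpolyC; ring.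
Qed.

Lemma lpowD r s : lpow (r + s) = lpow r * lpow s.
Proof.
by rewrite /lpow !expfzDr ?(valP l1) ?(valP l2) // mulrACA.
Qed.

Lemma wlie_hom (a b : F) r (c d : F) s
    (k := a * s.1%:~R + b * s.2%:~R) (l := c * r.1%:~R + d * r.2%:~R) :
  wlie (whom a b r) (whom c d s) = whom (k * c - l * a) (k * d - l * b) (r + s).
Proof.
have ld1Zm (e : F) t : ld1 (e *: lmon t) = (e * t.1%:~R) *: lmon t.
  by rewrite -[e *: _]addr0 ld1P ld10 addr0 ld1_mon scalerA.
have ld2Zm (e : F) t : ld2 (e *: lmon t) = (e * t.2%:~R) *: lmon t.
  by rewrite -[e *: _]addr0 ld2P ld20 addr0 ld2_mon scalerA.
by apply/pair_equal_spec; split;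
  rewrite /wapp /= !ld1Zm !ld2Zm -!scalerAl -!scalerAr !scalerA !lmonM
    (addrC s) -!scalerDl -scalerBl; congr (_ *: _); rewrite /k /l; ring.
Qed.

Lemma ohom_lie (a b : F) r (c d : F) s f
    (k := a * s.1%:~R + b * s.2%:~R) (l := c * r.1%:~R + d * r.2%:~R) :
  a * r.1%:~R + b * r.2%:~R = 0 -> c * s.1%:~R + d * s.2%:~R = 0 ->
  ohom (k * c - l * a) (k * d - l * b) (r + s) f =
  ohom a b r (ohom c d s f) - ohom c d s (ohom a b r f).
Proof.
move=> abr cds.
have hZ t (e : F) p : pshift t (e *: p) = e *: pshift t p by rewrite pshift.unlock linearZ.
rewrite /ohom !hZ !pshiftM !pshift_shift !pshift_factor (addrC s r).
rewrite -!scalerAr !scalerA lpowD (mulrC (lpow s)) -scalerBr; congr (_ *: _).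
rewrite !mulrA -mulrBl; congr (_ * _); rewrite -/k -/l.
have -> : ofactor a b r * (ofactor c d s - l%:MP) - ofactor c d s * (ofactor a b r - k%:MP)
   = k *: ofactor c d s - l *: ofactor a b r by rewrite -!mul_mpolyC; ring.
have -> : ofactor (k * c - l * a) (k * d - l * b) (r + s) =
    k *: ofactor c d (r + s) - l *: ofactor a b (r + s).
  by rewrite /ofactor -!mul_mpolyC !mpolyCB !mpolyCM; ring.
have [s0|s0] := eqVneq s 0.
  by rewrite /k s0 !mulr0 addr0 !scale0r addr0.
have [r0|r0] := eqVneq r 0.
  by rewrite /l r0 !mulr0 !addr0 !scale0r add0r.
have [rs|rs] := eqVneq (r + s) 0.
  have -> : r = - s by apply/eqP; rewrite -addr_eq0 rs.
  have kl : k = 0 /\ l = 0.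
    move: abr cds rs; rewrite /k /l => abr cds /eqP; rewrite addr_eq0 => /eqP rs.
    split; last by rewrite rs /= !mulrNz !mulrN -opprD cds oppr0.
    by apply/eqP; rewrite -oppr_eq0 opprD -!mulrN -!mulrNz -[X in X == _]/(a * (- s).1%:~R + b * (- s).2%:~R) -rs abr.
  by case: kl => -> ->; rewrite !scale0r.
by rewrite /ofactor rs r0 s0.
Qed.

Definition oact (x : divfree F) (f : Omega l1 l2 a1 a2) : Omega l1 l2 a1 a2 :=
  owact x f.

Fact oact_linear_l a x y f : oact (a *: x + y) f = a *: oact x f + oact y f.
Proof. exact: owact_linear_l. Qed.
Fact oact_linear_r a x f g : oact x (a *: f + g) = a *: oact x f + oact x g.
Proof. exact: owact_linear_r. Qed.

Fact oact_lie x y f : oact (lie x y) f = oact x (oact y f) - oact y (oact x f).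
Proof.
pose Q (z w : W) := owact (lie z w) f = owact z (owact w f) - owact w (owact z f).
change (Q x y).
have owD z w g : owact (z + w) g = owact z g + owact w g.
  by have := owact_linear_l 1 z w g; rewrite !scale1r.
have owDr z g h : owact z (g + h) = owact z g + owact z h.
  by have := owact_linear_r z 1 g h; rewrite !scale1r.
have BD (u v u' v' : P) : (u - v) + (u' - v') = (u + u') - (v + v').
  by rewrite opprD addrACA.
have ow0 g : owact 0 g = 0 by rewrite /owact /= !lext0 addr0.
have ow0r z : owact z 0 = 0 by apply: (addrI (owact z 0)); rewrite -owDr !addr0.
apply: (divfree_ind (P := Q^~ y)) => [|z z'|a b r abr]; rewrite /Q.
- by rewrite lie0l !ow0 ow0r subr0.
- by move=> IH IH'; rewrite lieDl !owD IH IH' owDr BD.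
apply: (divfree_ind (P := Q _)) => [|z z'|c d s cds]; rewrite /Q.
- by rewrite lie0r !ow0 ow0r subr0.
- by move=> IH IH'; rewrite lieDr !owD IH IH' owDr BD.
have -> : lie (whom a b r : W) (whom c d s) = wlie (whom a b r) (whom c d s) by [].
by rewrite wlie_hom !owact_hom ohom_lie.
Qed.

HB.instance Definition _ := isLieModule.Build F (divfree F) (Omega l1 l2 a1 a2)
  oact_linear_l oact_linear_r oact_lie.

Local Notation O := (Omega l1 l2 a1 a2).

Lemma pshift0 f : pshift 0 f = f.
Proof.
elim/mpoly2_ind: f => [|c m f IH]; first by rewrite pshift.unlock raddf0.
rewrite pshiftP IH mpolyX2 pshiftM; congr (_ *: (_ * _) + _);
by rewrite pshift.unlock rmorphXn /= comp_mpolyXU /= mpolyC0 subr0.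
Qed.

Lemma Omega_dfd1 (f : O) : lact (dfd1 F) f = (X1 * (f : P) : O).
Proof.
rewrite [LHS]/(owact (1, 0) f) /owact /= lext0 addr0 lext_mon /ohom /ofactor.
by rewrite pshift0 /lpow !expr0z mulr1 !scale1r scale0r eqxx mulr0n mpolyC0 !addr0.
Qed.

Lemma Omega_dfd2 (f : O) : lact (dfd2 F) f = (X2 * (f : P) : O).
Proof.
rewrite [LHS]/(owact (0, 1) f) /owact /= lext0 add0r lext_mon /ohom /ofactor.
rewrite pshift0 /lpow !expr0z mulr1 !scale1r scale0r eqxx mulr0n mpolyC0.
by rewrite add0r addr0.
Qed.

Lemma Omega_dfD r (f : O) : lact (dfD F r) f =
  ((sval l1 ^ r.1 * sval l2 ^ r.2) *:
   ((r.2%:~R *: (X1 + a1%:MP) - r.1%:~R *: (X2 + a2%:MP)) *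
    ((f : P) \mPo [tuple X1 - (r.1%:~R)%:MP; X2 - (r.2%:~R)%:MP])) : O).
Proof.
transitivity (owact (whom r.2%:~R (- r.1%:~R) r) f) => //.
rewrite owact_hom /ohom /ofactor pshift.unlock.
congr (_ *: (_ * _)); rewrite scaleNr.
by have [->|_] := eqVneq r 0; rewrite /= ?scale0r.
Qed.
End Omega.

(* Main.v *)
(* Write M = C[x, y] e.  Since [d_i, D_r] = r_i D_r, the element
   D_r = r_2 t^r d_1 - r_1 t^r d_2 sends f e to G_r f(x - r_1, y - r_2) e for some
   polynomial G_r, and the bracket relations become
   G_r s_r(G_s) - G_s s_s(G_r) = (r_2 s_1 - r_1 s_2) G_{r+s}, where s_r is the shift by r.
   If G_s = 0 for one s <> 0, then all G_r vanish.  Otherwise, the relation for (r, -r)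
   says that A(T) B(T - 1) is 1-periodic, where A and B are the restrictions of G_r and
   G_{-r} to the generic line v + T r; hence A is constant and G_r = g_r(r_2 x - r_1 y)
   for a univariate g_r.  For non-parallel r and s the two linear forms are independent,
   and comparing the top coefficients in one of them shows that g_r is affine.  Writing
   g_r(w) = p_r (w + c_r), the relation reads p_{r+s} = p_r p_s and c_{r+s} = c_r + c_s
   for non-parallel r and s, which forces p_r = l_1^{r_1} l_2^{r_2} and
   c_r = r_2 a_1 - r_1 a_2. *)
From HB Require Import structures.
Require Import Defs.
From mathcomp Require Import all_boot all_order all_algebra.
From mathcomp Require Import ring.
From mathcomp Require Import complex reals.
From mathcomp.multinomials Require Import mpoly.

Set Implicit Arguments.
Unset Strict Implicit.
Unset Printing Implicit Defensive.

Import GRing.Theory Num.Theory.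
Local Open Scope ring_scope.
Local Notation X1 := ('X_ord0).
Local Notation X2 := ('X_ord_max).

(** * Periodic univariate polynomials and degree comparison *)

Section PeriodicPoly.
Variable R : idomainType.
Hypothesis natr_inj : injective (fun n : nat => n%:R : R).
Implicit Types p q : {poly R}.

Lemma poly_eq0_natroots p : (forall n : nat, p.[n%:R] = 0) -> p = 0.
Proof.
move=> p0; apply/eqP; apply: contraT => nz_p.
have /(_ [seq n%:R | n <- iota 0 (size p)]) := max_poly_roots nz_p.
rewrite size_map size_iota ltnn (map_inj_uniq natr_inj) iota_uniq => -> //.
by apply/allP => _ /mapP[n _ ->]; apply/rootP.
Qed.

(** The value p(0) recurs at every n c, so p - p(0) has infinitely many roots; substituting c X
    moves them to the naturals. *)
Lemma periodic_polyC (c : R) p :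
  c != 0 -> p \Po ('X + c%:P) = p -> p = (p`_0)%:P.
Proof.
move=> nz_c pp; have pn (n : nat) : p.[n%:R * c] = p`_0.
  elim: n => [|n IH]; first by rewrite mul0r horner_coef0.
  rewrite -IH -[in RHS]pp horner_comp !hornerE; congr (p.[_]).
  by rewrite -natr1 mulrDl mul1r.
have : (p - (p`_0)%:P) \Po (c *: 'X) = 0.
  apply: poly_eq0_natroots => n.
  by rewrite horner_comp !hornerE mulrC pn subrr.
move/eqP; rewrite comp_poly2_eq0; last by rewrite size_scale ?size_polyX.
by rewrite subr_eq0 => /eqP.
Qed.

Lemma coef_comp_polyXaddC p (c : R) m :
  (size p <= m.+1)%N -> (p \Po ('X + c%:P))`_m = p`_m.
Proof.
have sz : size (p \Po ('X + c%:P)) = size p by rewrite size_comp_poly2 ?size_XaddC.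
rewrite leq_eqVlt ltnS => /orP[/eqP szp|le]; last by rewrite !nth_default ?sz.
have := lead_coef_comp p (q := 'X + c%:P).
by rewrite size_XaddC lead_coefXaddC expr1n mulr1 !lead_coefE sz szp => ->.
Qed.
End PeriodicPoly.

(** A(T) B(T - 1) is its own translate by 1, hence constant; degrees add in a domain, so A is
    constant too. *)
Lemma comm_shift_polyC (R : idomainType) (A B : {poly R}) :
  injective (fun n : nat => n%:R : R) -> A != 0 -> B != 0 ->
  A * (B \Po ('X - 1%:P)) = B * (A \Po ('X + 1%:P)) -> A = (A`_0)%:P.
Proof.
move=> natr_inj A0 B0 E.
have H0 : A * (B \Po ('X - 1%:P)) != 0.
  by apply: mulf_neq0 A0 _; rewrite comp_poly2_eq0 ?size_XsubC.
have BK : (B \Po ('X - 1%:P)) \Po ('X + 1%:P) = B.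
  by rewrite -comp_polyA comp_polyB comp_polyX comp_polyC addrK comp_polyXr.
have Hp : (A * (B \Po ('X - 1%:P))) \Po ('X + 1%:P) = A * (B \Po ('X - 1%:P)).
  by rewrite comp_polyM BK [RHS]E mulrC.
have /(congr1 (fun p : {poly R} => size p)) :=
  periodic_polyC natr_inj (oner_neq0 _) Hp.
rewrite size_mul ?comp_poly2_eq0 ?size_XsubC // size_comp_poly2 ?size_XsubC //.
rewrite size_polyC => szE; apply: size1_polyC.
move: szE A0 B0; rewrite -!size_poly_gt0.
case: (size A) (size B) => [|m] // [|n] //=.
rewrite addnS => szE _ _; have := leq_b1 ((A * (B \Po ('X - 1%:P)))`_0 != 0).
by rewrite -szE !ltnS leqn0 addn_eq0 => /andP[/eqP-> _].
Qed.

(** For fixed b both sides are polynomials in a. Comparing coefficients of a^m, with m the degree of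
    g, shows that k(b + d) - k(b) does not depend on b. *)
Lemma bracket_affine (F : numFieldType) (g k h : {poly F}) (d : F) :
    g != 0 -> d != 0 ->
    (forall a b, g.[a] * k.[b + d] - k.[b] * g.[a - d] = d * h.[a + b]) ->
  (size k <= 2)%N.
Proof.
move=> g0 d0 E; pose m := (size g).-1.
have natr_inj : injective (fun n : nat => n%:R : F).
  by move=> i j /eqP; rewrite eqr_nat => /eqP.
have szg : size g = m.+1 by rewrite /m prednK // size_poly_gt0.
have gm : g`_m != 0 by rewrite /m -lead_coefE lead_coef_eq0.
have Ep b : k.[b + d] *: g - k.[b] *: (g \Po ('X + (- d)%:P)) =
    d *: (h \Po ('X + b%:P)).
  apply/eqP; rewrite -subr_eq0; apply/eqP/(poly_eq0_natroots natr_inj) => n.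
  rewrite hornerD hornerN hornerD hornerN !hornerZ !horner_comp !hornerD.
  by rewrite !hornerX !hornerC -E; ring.
(* The case b = 0 bounds the degree of h by m, so translating h does not change its coefficient at
   m. *)
have szh : (size h <= m.+1)%N.
  have := congr1 (fun p : {poly F} => size p) (Ep 0).
  rewrite size_scale // size_comp_poly2 ?size_XaddC // => <-.
  apply: leq_trans (size_polyD _ _) _; rewrite size_polyN geq_max.
  apply/andP; split; apply: leq_trans (size_scale_leq _ _) _; rewrite ?szg //.
  by rewrite size_comp_poly2 ?size_XaddC ?szg.
have Em b : g`_m * (k.[b + d] - k.[b]) = d * h`_m.
  have /(congr1 (fun p : {poly F} => p`_m)) := Ep b.
  rewrite coefB !coefZ !coef_comp_polyXaddC ?szg // => <-; ring.
(* The increment of k over d is c d, so subtracting c X leaves a d-periodic polynomial. *)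
pose c := h`_m / g`_m.
have : (k - c *: 'X) \Po ('X + d%:P) = k - c *: 'X.
  apply/eqP; rewrite -subr_eq0; apply/eqP/(poly_eq0_natroots natr_inj) => n.
  rewrite hornerD hornerN horner_comp !hornerD !hornerN !hornerZ hornerX hornerC.
  rewrite hornerX; apply: (mulfI gm); rewrite mulr0 /c.
  transitivity (g`_m * (k.[n%:R + d] - k.[n%:R]) - h`_m / g`_m * g`_m * d).
    by ring.
  by rewrite Em mulfVK // mulrC subrr.
move/(periodic_polyC natr_inj d0)/eqP; rewrite subr_eq => /eqP ->.
apply: leq_trans (size_polyD _ _) _; rewrite geq_max.
apply/andP; split; first exact: leq_trans (size_polyC_leq1 _) _.
by apply: leq_trans (size_scale_leq _ _) _; rewrite size_polyX.
Qed.

(** * Functions on the lattice invariant under unit steps *)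

Lemma int_shift_const (T : Type) (u : int -> T) :
  (forall a, u (a + 1) = u a) -> forall a b, u a = u b.
Proof.
move=> uS; have u0 a : u a = u 0.
  elim/int_ind: a => // n IH; first by rewrite -addn1 PoszD uS.
  by rewrite -IH -(uS (- n.+1%:Z)) -addn1 PoszD opprD subrK.
by move=> a b; rewrite !u0.
Qed.

(** A unit step is allowed when it is not parallel to the current point. Points with b = 0 first
    move vertically to row 1, all others horizontally to column 1; neither route meets the
    origin. *)
Lemma lattice_const (T : Type) (u : int * int -> T) :
  (forall a b, b != 0 -> u (a + 1, b) = u (a, b)) ->
  (forall a b, a != 0 -> u (a, b + 1) = u (a, b)) ->
  forall r, r != 0 -> u r = u (1, 1).
Proof.
move=> u1 u2 [a b] ab0; have [b0|b0] := eqVneq b 0.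
  have a0 : a != 0 by apply: contraNneq ab0 => ->; rewrite b0.
  rewrite (int_shift_const (u := fun b => u (a, b)) _ b 1) => [|c]; last exact: u2.
  by rewrite (int_shift_const (u := fun a => u (a, 1)) _ a 1) // => c; apply: u1.
rewrite (int_shift_const (u := fun a => u (a, b)) _ a 1) => [|c]; last exact: u1.
by rewrite (int_shift_const (u := fun b => u (1, b)) _ b 1) // => c; apply: u2.
Qed.

(** * Substitution in bivariate polynomials *)

Section Ev2.
Variables (F : fieldType) (S : comNzRingType) (phi : {rmorphism F -> S}).
Local Notation P := {mpoly F[2]}.

(** The free target S lets one map cover shifts, generic lines, slices and points of F^2, all
    compared through [rmorph_ev2]. *)
Definition ev2 (a b : S) : P -> S := mmap phi (fun i => if i == ord0 then a else b).
HB.instance Definition _ a b := GRing.RMorphism.on (ev2 a b).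

Lemma ev2C a b c : ev2 a b c%:MP = phi c. Proof. exact: mmapC. Qed.
Lemma ev2X1 a b : ev2 a b X1 = a. Proof. by rewrite /ev2 mmapX mmap1U. Qed.
Lemma ev2X2 a b : ev2 a b X2 = b. Proof. by rewrite /ev2 mmapX mmap1U. Qed.

End Ev2.

Lemma rmorph_mpoly2 (F : fieldType) (S : nzRingType) (f g : {rmorphism {mpoly F[2]} -> S}) :
  (forall c, f c%:MP = g c%:MP) -> f X1 = g X1 -> f X2 = g X2 -> f =1 g.
Proof.
move=> ec e1 e2 p; elim/mpoly2_ind: p => [|c m p IH]; first by rewrite !raddf0.
by rewrite -mul_mpolyC mpolyX2 !(rmorphD, rmorphM, rmorphXn) /= IH ec e1 e2.
Qed.

Lemma pshiftE (F : fieldType) r (p : {mpoly F[2]}) :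
  pshift r p = ev2 (@mpolyC 2 F) (X1 - r.1%:~R%:MP) (X2 - r.2%:~R%:MP) p.
Proof.
rewrite pshift.unlock /comp_mpoly /ev2; apply: eq_bigr => m _.
congr (_ * _); apply: mmap1_eq => i; rewrite (tnth_nth 0).
by case: i => [] [|[|]].
Qed.

Lemma rmorph_ev2 (F : fieldType) (S S' : comNzRingType) (phi : {rmorphism F -> S})
    (psi : {rmorphism S -> S'}) (phi' : {rmorphism F -> S'}) a b a' b' p :
  (forall c, psi (phi c) = phi' c) -> psi a = a' -> psi b = b' ->
  psi (ev2 phi a b p) = ev2 phi' a' b' p.
Proof.
move=> ec <- <-; apply: (rmorph_mpoly2 (f := psi \o ev2 phi a b)) => [c||] /=.
- by rewrite !ev2C.
- by rewrite !ev2X1.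
- by rewrite !ev2X2.
Qed.

Lemma pshift_0 (F : fieldType) r : pshift r 0 = 0 :> {mpoly F[2]}.
Proof. by rewrite pshift.unlock raddf0. Qed.

(** The structure constant of [D_r, D_s]; it is nonzero exactly when r and s are not parallel. *)
Definition cross (r s : int * int) : int := r.2 * s.1 - r.1 * s.2.

Lemma cross_neq0 r s : cross r s != 0 -> [/\ r != 0, s != 0 & r + s != 0].
Proof.
move=> d; split; apply: contraNneq d; rewrite /cross.
- by move=> ->; rewrite !mul0r subrr.
- by move=> ->; rewrite !mulr0 subrr.
move/eqP; rewrite addr_eq0 => /eqP -> /=; apply/eqP; ring.
Qed.

Lemma cross_exists r : r != 0 -> exists s, cross r s != 0.
Proof.
(* The vector orthogonal to (a, b) gives a^2 + b^2. *)
case: r => a b ab0; exists (b, - a); rewrite /cross /= mulrN opprK.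
apply: contra ab0; rewrite paddr_eq0 ?sqr_ge0 //.
by rewrite !mulf_eq0 !orbb => /andP[/eqP-> /eqP->].
Qed.

(** * Solving the bracket relations *)

Section BracketFamily.
Variables (F : numFieldType) (G : int * int -> {mpoly F[2]}).
Local Notation P := {mpoly F[2]}.
Implicit Types r s : int * int.
Hypothesis G0 : G 0 = 0.
Hypothesis GB : forall r s,
  G r * pshift r (G s) - G s * pshift s (G r) = (cross r s)%:~R *: G (r + s).
Hypothesis G_nontriv : exists s, G s != 0.

Let iP : {rmorphism F -> {poly P}} := polyC \o @mpolyC 2 F.

(* p(v + T r), as a polynomial in T *)
Definition line r : P -> {poly P} :=
  ev2 iP ((X1 : P)%:P + (r.1%:~R)%:P * 'X) ((X2 : P)%:P + (r.2%:~R)%:P * 'X).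
HB.instance Definition _ r := GRing.RMorphism.on (line r).

(** A shift by k r moves v + T r along its own line, to the parameter T - k. *)
Lemma line_pshift (k : int) r s p : s = (k * r.1, k * r.2) ->
  line r (pshift s p) = line r p \Po ('X - (k%:~R)%:P).
Proof.
move=> ->; rewrite pshiftE.
have iPz (z : int) : line r (z%:~R)%:MP = ((z%:~R : P)%:P).
  by rewrite /line ev2C /= (rmorph_int (@mpolyC 2 F)).
rewrite (@rmorph_ev2 _ _ _ _ (line r) iP _ _
  ((X1 : P)%:P + (r.1%:~R)%:P * ('X - (k%:~R)%:P))
  ((X2 : P)%:P + (r.2%:~R)%:P * ('X - (k%:~R)%:P))) /=.
- apply/esym; apply: (@rmorph_ev2 F {poly P} {poly P} iP
    (comp_poly ('X - (k%:~R)%:P)) iP _ _ _ _ p) => [c||] /=.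
  + by rewrite comp_polyC.
  + by rewrite !(rmorphD, rmorphM) /= !comp_polyC comp_polyX.
  + by rewrite !(rmorphD, rmorphM) /= !comp_polyC comp_polyX.
- by move=> c; rewrite /line ev2C.
- by rewrite rmorphB /= iPz /line ev2X1 intrM polyCM; ring.
- by rewrite rmorphB /= iPz /line ev2X2 intrM polyCM; ring.
Qed.

Lemma horner_line r p q :
  (line r p).[q] = ev2 (@mpolyC 2 F) (X1 + r.1%:~R * q) (X2 + r.2%:~R * q) p.
Proof.
apply: (@rmorph_ev2 F {poly P} P iP (horner_eval q) (@mpolyC 2 F)) => [c||].
- exact: hornerC.
- by rewrite /= horner_evalE !hornerE.
- by rewrite /= horner_evalE !hornerE.
Qed.

Lemma ev2_id p : ev2 (@mpolyC 2 F) X1 X2 p = p.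
Proof.
apply: (rmorph_mpoly2 (f := ev2 (@mpolyC 2 F) X1 X2) (g := idfun)) => [c||] /=.
- exact: ev2C.
- exact: ev2X1.
- exact: ev2X2.
Qed.

Lemma line_eq0 r p : (line r p == 0) = (p == 0).
Proof.
apply/eqP/eqP => [p0|->]; last exact: rmorph0.
by have := horner_line r p 0; rewrite p0 horner0 !mulr0 !addr0 ev2_id.
Qed.

Lemma natr_inj_mpoly : injective (fun n : nat => n%:R : P).
Proof.
move=> m n /eqP; rewrite -!(rmorph_nat (@mpolyC 2 F)).
by rewrite mpolyC_eq eqr_nat => /eqP.
Qed.

(** The relation for (s, t - s) carries a zero at s to every t not parallel to s. A vector t
    parallel to r is reached from r through a third, non-parallel vector. *)
Lemma G_neq0 r : r != 0 -> G r != 0.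
Proof.
have H s t : G s = 0 -> cross s t != 0 -> G (s + t) = 0.
  move=> Gs st; have := GB s t.
  rewrite Gs pshift_0 mul0r mulr0 subr0 => /esym/eqP.
  by rewrite -mul_mpolyC mulf_eq0 mpolyC_eq0 intr_eq0 (negPf st) => /eqP.
have H' s t : G s = 0 -> cross s t != 0 -> G t = 0.
  move=> Gs st; rewrite -(subrKC s t); apply: H => //.
  by move: st; rewrite /cross /=; congr (_ != 0); ring.
move=> r0; apply/negP => /eqP Gr; case: G_nontriv => t.
have [s rs] := cross_exists r0.
have [->|t0] := eqVneq t 0; first by rewrite G0 eqxx.
have [rt|rt] := eqVneq (cross r t) 0; last by rewrite (H' _ _ Gr rt) eqxx.
rewrite (H' s t) ?eqxx //; first exact: H' Gr rs.
(* By Cramer's rule, a t parallel to both r and s would be 0. *)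
apply: contra t0 => /eqP st.
have e1 : cross r s * t.1 = 0.
  have -> : cross r s * t.1 = s.1 * cross r t - r.1 * cross s t.
    by rewrite /cross; ring.
  by rewrite rt st !mulr0 subrr.
have e2 : cross r s * t.2 = 0.
  have -> : cross r s * t.2 = s.2 * cross r t - r.2 * cross s t.
    by rewrite /cross; ring.
  by rewrite rt st !mulr0 subrr.
move/eqP: e1; rewrite mulf_eq0 (negPf rs) => /= /eqP e1.
move/eqP: e2; rewrite mulf_eq0 (negPf rs) => /= /eqP e2.
by rewrite -pair_eqE /pair_eq e1 e2 !eqxx.
Qed.

(** In the relation for (r, -r) the right side is a multiple of G_0 = 0, and on the line the two
    shifts become T - 1 and T + 1, as in [comm_shift_polyC]. *)
Lemma line_G r : r != 0 -> line r (G r) = (G r)%:P.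
Proof.
move=> r0; pose A := line r (G r); pose B := line r (G (- r)).
have A0 : A != 0 by rewrite line_eq0 G_neq0.
have B0 : B != 0 by rewrite line_eq0 G_neq0 // oppr_eq0.
have E : A * (B \Po ('X - 1%:P)) = B * (A \Po ('X + 1%:P)).
  have /(congr1 (line r)) := GB r (- r).
  rewrite subrr G0 scaler0 rmorph0 rmorphB !rmorphM /= => /eqP.
  rewrite subr_eq0 => /eqP.
  rewrite (@line_pshift 1 r r); last by rewrite !mul1r; case: (r).
  rewrite (@line_pshift (-1) r (- r)); last by rewrite !mulN1r; case: (r).
  by rewrite mulrN1z polyCN opprK.
rewrite -/A (comm_shift_polyC natr_inj_mpoly A0 B0 E) -horner_coef0 horner_line.
by rewrite !mulr0 !addr0 ev2_id.
Qed.

(* The univariate g_r with G(r) = g_r(r_2 x - r_1 y), meaningful for r <> 0. *)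
Definition slice r : {poly F} :=
  if r.2 != 0 then ev2 (@polyC F) ((r.2%:~R)^-1 *: 'X) 0 (G r)
  else ev2 (@polyC F) 0 (- (r.1%:~R)^-1 *: 'X) (G r).

Local Notation W r := (r.2%:~R *: X1 - r.1%:~R *: X2 : P).

(** With w = r_2 x - r_1 y, the hypotheses place (u1 w, u2 w) on the line v + T r at T = q, and G_r
    is constant along that line. *)
Lemma slice_line r (u1 u2 : F) (q : P) : r != 0 ->
    u1 *: W r = X1 + r.1%:~R * q -> u2 *: W r = X2 + r.2%:~R * q ->
  (map_poly (@mpolyC 2 F) (ev2 (@polyC F) (u1 *: 'X) (u2 *: 'X) (G r))).[W r] = G r.
Proof.
move=> r0 e1 e2; rewrite -[RHS](hornerC (G r) q) -line_G // horner_line -e1 -e2.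
rewrite -horner_evalE.
apply: (@rmorph_ev2 F {poly F} P (@polyC F)
  (horner_eval (W r) \o map_poly (@mpolyC 2 F)) (@mpolyC 2 F)) => [c||] /=.
- by rewrite map_polyC horner_evalE hornerC.
- by rewrite horner_evalE map_polyZ map_polyX hornerZ hornerX mul_mpolyC.
- by rewrite horner_evalE map_polyZ map_polyX hornerZ hornerX mul_mpolyC.
Qed.

Lemma sliceE r : r != 0 -> (map_poly (@mpolyC 2 F) (slice r)).[W r] = G r.
Proof.
move=> r0; rewrite /slice; case: ifPn => [r2|].
  have r2F : r.2%:~R != 0 :> F by rewrite intr_eq0.
  rewrite -[in X in ev2 _ _ X _](scale0r 'X).
  (* At T = - y / r_2 the line meets the axis y = 0. *)
  apply: (slice_line (q := - (r.2%:~R)^-1 *: X2)) => //.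
    rewrite scalerBr !scalerA mulVf // scale1r -!mul_mpolyC.
    by rewrite -(rmorph_int (@mpolyC 2 F)) mpolyCM !mpolyCN; ring.
  rewrite scale0r -(rmorph_int (@mpolyC 2 F)) mul_mpolyC scalerA mulrN.
  by rewrite mulfV // scaleN1r subrr.
rewrite negbK => r2.
have r1F : r.1%:~R != 0 :> F.
  by rewrite intr_eq0; apply: contra r0 => r1; rewrite -pair_eqE /pair_eq r1 r2.
rewrite -[in X in ev2 _ X](scale0r 'X).
(* At T = - x / r_1 the line meets the axis x = 0. *)
apply: (slice_line (q := - (r.1%:~R)^-1 *: X1)) => //.
  rewrite scale0r -(rmorph_int (@mpolyC 2 F)) mul_mpolyC scalerA mulrN.
  by rewrite mulfV // scaleN1r subrr.
by rewrite (eqP r2) scale0r sub0r scaleNr scalerN opprK scalerA mulVf // scale1r mul0r addr0.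
Qed.

Lemma slice_neq0 r : r != 0 -> slice r != 0.
Proof.
by move=> r0; apply: contraNneq (G_neq0 r0) => g0; rewrite -sliceE // g0 rmorph0 horner0.
Qed.

Lemma ev2_G r (x y : F) : r != 0 ->
  ev2 idfun x y (G r) = (slice r).[r.2%:~R * x - r.1%:~R * y].
Proof.
move=> r0; rewrite -sliceE //; elim/poly_ind: (slice r) => [|p c IH].
  by rewrite !(rmorph0, horner0).
rewrite rmorphD rmorphM /= map_polyX map_polyC !hornerE rmorphD rmorphM /= IH.
by rewrite ev2C /= -!mul_mpolyC rmorphB !rmorphM /= !ev2C ev2X1 ev2X2.
Qed.

Lemma ev2_pshift r p (x y : F) :
  ev2 idfun x y (pshift r p) = ev2 idfun (x - r.1%:~R) (y - r.2%:~R) p.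
Proof.
rewrite pshiftE; apply: (@rmorph_ev2 F P F (@mpolyC 2 F) (ev2 idfun x y) idfun) => [c||].
- exact: ev2C.
- by rewrite rmorphB /= ev2X1 ev2C.
- by rewrite rmorphB /= ev2X2 ev2C.
Qed.

(** The linear forms of r and s are independent, so they take any prescribed values a and b. The
    shift by r adds d to the form of s, and the shift by s subtracts d from the form of r. *)
Lemma slice_bracket r s (a b : F) (d : F := (cross r s)%:~R) : cross r s != 0 ->
  (slice r).[a] * (slice s).[b + d] - (slice s).[b] * (slice r).[a - d] =
  d * (slice (r + s)).[a + b].
Proof.
move=> rs; have [r0 s0 rs0] := cross_neq0 rs.
have d0 : d != 0 by rewrite intr_eq0.
(* Cramer's solution of r_2 x - r_1 y = a, s_2 x - s_1 y = b. *)
pose x := (a * s.1%:~R - b * r.1%:~R) / d.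
pose y := (a * s.2%:~R - b * r.2%:~R) / d.
have dE : d = r.2%:~R * s.1%:~R - r.1%:~R * s.2%:~R.
  by rewrite /d /cross intrB !intrM.
have xr : r.2%:~R * x - r.1%:~R * y = a.
  by apply: (mulIf d0); rewrite mulrBl /x /y !mulrA !mulfVK // dE; ring.
have xs : s.2%:~R * x - s.1%:~R * y = b.
  by apply: (mulIf d0); rewrite mulrBl /x /y !mulrA !mulfVK // dE; ring.
have /(congr1 (ev2 idfun x y)) := GB r s.
rewrite -mul_mpolyC rmorphB !rmorphM /= ev2C !ev2_pshift !ev2_G // xr xs.
have -> : s.2%:~R * (x - r.1%:~R) - s.1%:~R * (y - r.2%:~R) = b + d.
  by rewrite -xs dE; ring.
have -> : r.2%:~R * (x - s.1%:~R) - r.1%:~R * (y - s.2%:~R) = a - d.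
  by rewrite -xr dE; ring.
have -> : (r + s).2%:~R * x - (r + s).1%:~R * y = a + b.
  by rewrite -xr -xs /= !intrD; ring.
by [].
Qed.

(** For g_r(w) = p_r (w + c_r), [slope] is p_r and [offset] is p_r c_r; c_r itself needs p_r to be
    nonzero. *)
Definition slope r := (slice r)`_1.
Definition offset r := (slice r)`_0.

Lemma slice_affine r : r != 0 -> slice r = slope r *: 'X + (offset r)%:P.
Proof.
move=> r0; have [s rs] := cross_exists r0.
(* [bracket_affine] bounds the second polynomial of the pair, so r enters in second place. *)
have sr : cross s r != 0.
  by apply: contra rs; rewrite /cross !subr_eq0 eq_sym mulrC (mulrC s.2).
have [s0 _ _] := cross_neq0 sr.
have := bracket_affine (slice_neq0 s0) _ (fun a b => slice_bracket a b sr).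
rewrite intr_eq0 sr => /(_ isT) sz; apply/polyP => i.
rewrite coefD coefZ coefX coefC; case: i => [|[|i]] /=.
- by rewrite mulr0 add0r.
- by rewrite mulr1 addr0.
- by rewrite mulr0 addr0 nth_default // (leq_trans sz).
Qed.

Lemma horner_slice r a : r != 0 -> (slice r).[a] = slope r * a + offset r.
Proof. by move=> r0; rewrite slice_affine // hornerD hornerZ hornerX hornerC. Qed.

(** For affine slices both sides of the bracket relation are affine in a + b: the point (0, 0)
    yields the offsets, (1, 0) the slopes. *)
Lemma slope_offset_add r s : cross r s != 0 ->
  slope (r + s) = slope r * slope s /\
  offset (r + s) = offset r * slope s + offset s * slope r.
Proof.
move=> rs; have [r0 s0 rs0] := cross_neq0 rs.
have d0 : (cross r s)%:~R != 0 :> F by rewrite intr_eq0.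
have Q : offset (r + s) = offset r * slope s + offset s * slope r.
  have := slice_bracket 0 0 rs; rewrite !horner_slice // => E.
  apply: (mulfI d0); apply: etrans (_ : _ = (cross r s)%:~R *
    (slope (r + s) * (0 + 0) + offset (r + s))) _; first by ring.
  by rewrite -E; ring.
split=> //; have := slice_bracket 1 0 rs; rewrite !horner_slice // Q => E.
apply: (mulfI d0); apply: (addIr ((cross r s)%:~R * (offset r * slope s + offset s * slope r))).
apply: etrans (_ : _ = (cross r s)%:~R *
    (slope (r + s) * (1 + 0) + (offset r * slope s + offset s * slope r))) _.
  by ring.
by rewrite -E; ring.
Qed.

(** If p_r = 0, adding r to s once kills the slope and adding it again kills the offset, so the
    slice at 2r + s would vanish. *)
Lemma slope_neq0 r : r != 0 -> slope r != 0.
Proof.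
move=> r0; apply/eqP => pr; have [s rs] := cross_exists r0.
have [p1 q1] := slope_offset_add rs.
have rrs : cross r (r + s) != 0.
  by move: rs; rewrite /cross /=; congr (_ != 0); ring.
have [p2 q2] := slope_offset_add rrs.
have [_ _ nz] := cross_neq0 rrs.
by have /eqP[] := slice_neq0 nz; rewrite slice_affine //
  p2 q2 p1 pr !(mul0r, mulr0, scale0r, addr0).
Qed.

Lemma bracket_family : exists (l1 l2 : nonzero F) (a1 a2 : F), forall r,
  G r = lpow l1 l2 r *: (r.2%:~R *: (X1 + a1%:MP) - r.1%:~R *: (X2 + a2%:MP)).
Proof.
have l10 : slope (1, 0) != 0 by rewrite slope_neq0.
have l20 : slope (0, 1) != 0 by rewrite slope_neq0.
pose l1 : nonzero F := exist (fun l : F => is_true (l != 0)) _ l10.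
pose l2 : nonzero F := exist (fun l : F => is_true (l != 0)) _ l20.
pose c r := offset r / slope r.
(* Forced by c_r = r_2 a_1 - r_1 a_2 at the two unit vectors. *)
pose a1 := c (0, 1); pose a2 := - c (1, 0).
exists l1, l2, a1, a2 => r.
have [->|r0] := eqVneq r 0; first by rewrite G0 !scale0r subrr scaler0.
have cD s t : cross s t != 0 -> c (s + t) = c s + c t.
  move=> st; have [s0 t0 _] := cross_neq0 st.
  rewrite /c; have [-> ->] := slope_offset_add st.
  by field; rewrite !slope_neq0.
have e1 (a b : int) : (a + 1, b) = (a, b) + (1, 0) :> (int * int)
    by apply/pair_equal_spec; split; rewrite /= ?addr0.
have e2 (a b : int) : (a, b + 1) = (a, b) + (0, 1) :> (int * int)
    by apply/pair_equal_spec; split; rewrite /= ?addr0.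
have x1 (a b : int) : b != 0 -> cross (a, b) (1, 0) != 0.
  by rewrite /cross /= mulr1 mulr0 subr0.
have x2 (b a : int) : a != 0 -> cross (a, b) (0, 1) != 0.
  by rewrite /cross /= mulr1 mulr0 sub0r oppr_eq0.
have lp0 s : lpow l1 l2 s != 0 by rewrite mulf_neq0 // expfz_neq0.
(* The quotient of the two sides is invariant under the allowed unit steps and equals 1 at (1, 1);
   [cE] below treats the difference likewise. *)
have pE : slope r = lpow l1 l2 r.
  apply: (mulIf (invr_neq0 (lp0 r))); rewrite divff //.
  rewrite (lattice_const (u := fun s => slope s / lpow l1 l2 s) _ _ r0).
  - have /slope_offset_add[-> _] : cross (1, 0) (0, 1) != 0 by [].
    by rewrite /lpow /= !expr1z divff // mulf_neq0.
  - move=> a b /(x1 a) /slope_offset_add[]; rewrite -e1 => -> _.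
    by rewrite e1 lpowD {2}/lpow /= expr1z expr0z mulr1 -mulf_div divff // mulr1.
  - move=> a b /(x2 b) /slope_offset_add[]; rewrite -e2 => -> _.
    by rewrite e2 lpowD {2}/lpow /= expr1z expr0z mul1r -mulf_div divff // mulr1.
have cE : c r = r.2%:~R * a1 - r.1%:~R * a2.
  apply/eqP; rewrite -subr_eq0; apply/eqP.
  rewrite (lattice_const (u := fun s => c s - (s.2%:~R * a1 - s.1%:~R * a2)) _ _ r0).
  - rewrite (_ : (1, 1) = (1, 0) + (0, 1)) // cD //=.
    by rewrite /a1 /a2 /=; ring.
  - by move=> a b /(x1 a) ab; rewrite e1 cD //= !addr0 intrD /a1 /a2; ring.
  - by move=> a b /(x2 b) ab; rewrite e2 cD //= !addr0 intrD /a1; ring.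
rewrite -sliceE // slice_affine // rmorphD /= map_polyZ map_polyX map_polyC.
rewrite !hornerE -pE.
have -> : offset r = slope r * (r.2%:~R * a1 - r.1%:~R * a2).
  by rewrite -cE /c mulrC mulfVK // slope_neq0.
by rewrite -!mul_mpolyC /= !(mpolyCM, mpolyCB); ring.
Qed.
End BracketFamily.

(** * Generators of free modules of rank one; inverse isomorphisms *)

Lemma free_rank1_generator (U : nzRingType) (N : lmodType U) :
  free_of_rank 1 N -> exists e : N, bijective (fun c : U => c *: e).
Proof.
case=> e eP; exists (e ord0).
(* The boolean equality lets [xchoose] pick the coordinate below. *)
have ex m : exists c : U, m == c *: e ord0.
  by case: (eP m) => c [mE _]; exists (c 0 0); rewrite mE big_ord1.
have inj : injective (fun c : U => c *: e ord0).
  move=> c c' E; case: (eP (c *: e ord0)) => d [_ dU].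
  have E1 : d = const_mx c by apply: dU; rewrite big_ord1 mxE.
  have E2 : d = const_mx c' by apply: dU; rewrite big_ord1 mxE.
  by move: E1; rewrite E2 => /matrixP/(_ 0 0); rewrite !mxE.
have xK : cancel (fun m => xchoose (ex m)) (fun c : U => c *: e ord0).
  by move=> m; apply/esym/eqP; exact: (xchooseP (ex m)).
by exists (fun m => xchoose (ex m)) => // c; apply: inj; exact: xK.
Qed.

Lemma lieMod_iso_sym (F : fieldType) (L : lieAlgType F) (M N : lieModType L) :
  lieMod_iso M N -> lieMod_iso N M.
Proof.
case=> f [[g fK gK] fL].
pose gl := GRing.isLinear.Build F N M _ g (can2_linear fK gK).
pose g' : {linear N -> M} := HB.pack_for {linear N -> M} g gl.
exists g'; split; first by exists f.
by move=> x n; apply: (can_inj fK); rewrite fL !gK.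
Qed.

(** * Spanning set of the divergence-zero algebra and its brackets *)

Section Span.
Variable F : numFieldType.

Lemma divfree_span (Q : divfree F -> Prop) :
    Q (dfd1 F) -> Q (dfd2 F) -> (forall r, Q (dfD F r)) ->
    (forall a x y, Q x -> Q y -> Q (a *: x + y)) ->
  forall x, Q x.
Proof.
move=> Q1 Q2 QD QP.
have Q0 : Q 0 by rewrite -(addNr (dfd1 F)) -scaleN1r; apply: QP.
have QZ a x : Q x -> Q (a *: x) by move=> Qx; rewrite -[_ *: _]addr0; apply: QP.
have QA x y : Q x -> Q y -> Q (x + y).
  by move=> Qx Qy; rewrite -[x]scale1r; apply: QP.
(* [divfree_ind] needs a predicate on all Witt elements, whereas Q lives on the subalgebra. *)
suff H x : exists2 y : divfree F, dfval y = dfval x & Q y.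
  by move=> x; have [y /val_inj <-] := H x.
apply: (divfree_ind (P := fun w => exists2 y : divfree F, dfval y = w & Q y)).
- by exists 0.
- by move=> _ _ [y <- Qy] [z <- Qz]; exists (y + z) => //; apply: QA.
move=> a b r abr; have [r0|r0] := eqVneq r 0.
  exists (a *: dfd1 F + b *: dfd2 F); last by apply: QP => //; apply: QZ.
  by rewrite /= r0; apply/pair_equal_spec; split; rewrite /= scaler0 ?addr0 ?add0r.
(* Zero divergence makes (a, b) proportional to (r_2, - r_1); the ratio is read off a nonzero
   coordinate. *)
have [r2|r2] := eqVneq r.2 0; last first.
  have r2F : r.2%:~R != 0 :> F by rewrite intr_eq0.
  exists ((a / r.2%:~R) *: dfD F r); last exact: QZ.
  apply/pair_equal_spec; split; rewrite /= scalerA; first by rewrite mulfVK.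
  congr (_ *: _); apply: (mulIf r2F); rewrite mulrAC mulfVK //.
  by apply/eqP; rewrite mulrN -subr_eq0 -opprD abr oppr0.
have r1 : r.1 != 0.
  by apply: contra r0 => r1; rewrite -pair_eqE /pair_eq r1 r2 eqxx.
have r1F : r.1%:~R != 0 :> F by rewrite intr_eq0.
exists ((- b / r.1%:~R) *: dfD F r); last exact: QZ.
apply/pair_equal_spec; split; rewrite /= scalerA.
  move/eqP: abr; rewrite r2 !mulr0 addr0 mulf_eq0 (negPf r1F) orbF => /eqP->.
  by [].
by rewrite mulrN mulfVK // opprK.
Qed.

Lemma lie_dfD r s : lie (dfD F r) (dfD F s) = (cross r s)%:~R *: dfD F (r + s).
Proof.
apply: val_inj; rewrite [LHS]wlie_hom [RHS]/= /whom.
apply/pair_equal_spec; split; rewrite scalerA /=; congr (_ *: _);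
  rewrite /cross intrB !intrM !intrD; ring.
Qed.

Lemma lie_dfd1_dfD r : lie (dfd1 F) (dfD F r) = r.1%:~R *: dfD F r.
Proof.
apply: val_inj.
have -> : val (lie (dfd1 F) (dfD F r)) = wlie (whom 1 0 0) (whom r.2%:~R (- r.1%:~R) r).
  by rewrite /whom scale1r scale0r.
rewrite wlie_hom add0r.
by apply/pair_equal_spec; split; rewrite /= scalerA; congr (_ *: _); ring.
Qed.

Lemma lie_dfd2_dfD r : lie (dfd2 F) (dfD F r) = r.2%:~R *: dfD F r.
Proof.
apply: val_inj.
have -> : val (lie (dfd2 F) (dfD F r)) = wlie (whom 0 1 0) (whom r.2%:~R (- r.1%:~R) r).
  by rewrite /whom scale1r scale0r.
rewrite wlie_hom add0r.
by apply/pair_equal_spec; split; rewrite /= scalerA; congr (_ *: _); ring.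
Qed.
End Span.

(** * From the module to the family G, and the isomorphism with Omega *)

Section Module.
Variables (F : numFieldType) (M : lieModType (divfree F)).
Local Notation P := {mpoly F[2]}.
Implicit Types (p q : P) (v : M) (r s : int * int).

Lemma uact_X1 v : uact X1 v = lact (dfd1 F) v.
Proof. by rewrite uactX !mnm1E. Qed.

Lemma uact_X2 v : uact X2 v = lact (dfd2 F) v.
Proof. by rewrite uactX !mnm1E. Qed.

Lemma uactZ a p v : uact (a *: p) v = a *: (uact p v : M).
Proof. by have := uact_linear_l a p 0 (v : resU M); rewrite uact0l !addr0. Qed.

(** The weight relation reads D_r d_i = (d_i - r_i) D_r; the rule passes from the variables to
    products and linear combinations. *)
Lemma lact_dfD_uact r p v :
  lact (dfD F r) (uact p v : M) = uact (pshift r p) (lact (dfD F r) v) :> M.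
Proof.
set D := lact (dfD F r).
pose Q p := forall v, D (uact p v : M) = uact (pshift r p) (D v) :> M.
have QM q1 q2 : Q q1 -> Q q2 -> Q (q1 * q2).
  by move=> Qp Qq w; rewrite -uactA Qp Qq uactA -pshiftM.
have QX1 : Q X1.
  move=> w; rewrite uact_X1 pshift.unlock comp_mpolyXU /=.
  have /= := uact_linear_l (- r.1%:~R) 1 X1 (D w : resU M).
  rewrite -mul_mpolyC mulr1 mpolyCN addrC => ->; rewrite uact1 uact_X1.
  apply/eqP; rewrite scaleNr addrC -subr_eq0 opprB addrCA.
  have /eqP := lact_lie (dfd1 F) (dfD F r) w.
  rewrite lie_dfd1_dfD lactZl -subr_eq0 opprB => /eqP E.
  by rewrite -[X in _ == X]E; apply/eqP; rewrite /D; congr (_ + _); rewrite addrC.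
have QX2 : Q X2.
  move=> w; rewrite uact_X2 pshift.unlock comp_mpolyXU /=.
  have /= := uact_linear_l (- r.2%:~R) 1 X2 (D w : resU M).
  rewrite -mul_mpolyC mulr1 mpolyCN addrC => ->; rewrite uact1 uact_X2.
  apply/eqP; rewrite scaleNr addrC -subr_eq0 opprB addrCA.
  have /eqP := lact_lie (dfd2 F) (dfD F r) w.
  rewrite lie_dfd2_dfD lactZl -subr_eq0 opprB => /eqP E.
  by rewrite -[X in _ == X]E; apply/eqP; rewrite /D; congr (_ + _); rewrite addrC.
have Q1 : Q 1 by move=> w; rewrite uact1 pshift.unlock rmorph1 uact1.
have QXn q n : Q q -> Q (q ^+ n).
  by move=> Qq; elim: n => // n IH; rewrite exprS; apply: QM.
suff H q : Q q by apply: H.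
elim/mpoly2_ind: q => [|c m q IH] w.
  by rewrite uact0l pshift.unlock raddf0 uact0l /D lact0r.
rewrite uact_linear_l /D lact_linear_r -/D pshiftP uact_linear_l IH mpolyX2.
by congr (_ *: _ + _); apply: QM; apply: QXn.
Qed.

Variables (e : M) (coord : M -> P).
Hypothesis uactK : cancel (fun p => uact p e) coord.
Hypothesis coordK : cancel coord (fun p => uact p e).

(** The polynomial G_r, determined by D_r e = G_r e. *)
Definition lact_coef r : P := coord (lact (dfD F r) e).

Lemma lact_dfD_gen r p :
  lact (dfD F r) (uact p e : M) = uact (pshift r p * lact_coef r) e :> M.
Proof. by rewrite lact_dfD_uact -{1}[lact _ e]coordK uactA. Qed.

Lemma lact_coef0 : lact_coef 0 = 0.
Proof.
apply: (can_inj uactK); rewrite [uact _ _]coordK uact0l.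
have -> : dfD F 0 = 0; last by rewrite lact0l.
by apply: val_inj; apply/pair_equal_spec; split; rewrite /= ?oppr0 scale0r.
Qed.

Lemma lact_coef_bracket r s :
  lact_coef r * pshift r (lact_coef s) - lact_coef s * pshift s (lact_coef r) =
  (cross r s)%:~R *: lact_coef (r + s).
Proof.
apply: (can_inj uactK) => /=; rewrite uactZ [uact _ _ in RHS]coordK -lactZl -lie_dfD.
rewrite lact_lie -[lact (dfD F s) e]coordK -[lact (dfD F r) e in RHS]coordK.
rewrite !lact_dfD_gen -/(lact_coef s) -/(lact_coef r).
have -> : - uact (pshift s (lact_coef r) * lact_coef s) e =
    uact (- (pshift s (lact_coef r) * lact_coef s)) e :> M.
  by rewrite -(scaleN1r (pshift _ _ * _)) uactZ scaleN1r.
by rewrite -uactDl mulrC [lact_coef s * _]mulrC.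
Qed.

(** If every G_r vanished, the whole algebra would act through commuting polynomials in d_1 and d_2,
    and brackets would act by 0. *)
Lemma lact_coef_nontriv :
  (exists x : divfree F, in_derived x /\ exists m : M, lact x m <> 0) ->
  exists s, lact_coef s != 0.
Proof.
set N := exists s, _.
(* The existence of s is not decided in advance, so it is carried along as an alternative. *)
have mulP x : N \/ exists p, forall m : M, lact x m = uact p m.
  elim/divfree_span: x => [|||a x y]; last 1 first.
  - case=> [?|[p pE]]; first by left.
    case=> [?|[q qE]]; [by left|right; exists (a *: p + q) => m].
    by rewrite lactDl lactZl pE qE uact_linear_l.
  - by right; exists X1 => m; rewrite uact_X1.
  - by right; exists X2 => m; rewrite uact_X2.
  move=> r; have [r0|?] := eqVneq (lact_coef r) 0; last by left; exists r.
  by right; exists 0 => m; rewrite -(coordK m) lact_dfD_gen r0 mulr0 !uact0l.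
case=> x [[l ->] [m lm]].
have : N \/ lact (\sum_(p <- l) lie p.1 p.2) m = 0; last by case.
elim: l {lm} => [|[y z] l IH]; first by right; rewrite big_nil lact0l.
rewrite big_cons lactDl lact_lie /=.
case: (mulP y) => [?|[p pE]]; first by left.
case: (mulP z) => [?|[q qE]]; first by left.
case: IH => [?|->]; [by left|right].
by rewrite !pE !qE !uactA mulrC subrr addr0.
Qed.

Lemma gen_iso_Omega (l1 l2 : nonzero F) (a1 a2 : F) :
  (forall r, lact_coef r = lpow l1 l2 r *:
    (r.2%:~R *: (X1 + a1%:MP) - r.1%:~R *: (X2 + a2%:MP))) ->
  lieMod_iso M (Omega l1 l2 a1 a2).
Proof.
(* The explicit map p -> p e goes from Omega to M. *)
move=> GE; apply: lieMod_iso_sym; pose O := Omega l1 l2 a1 a2.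
pose f (p : O) : M := uact p e.
have fP : linear f by move=> a p q; rewrite /f uact_linear_l.
pose fl := GRing.isLinear.Build F O M _ f fP.
pose f' : {linear O -> M} := HB.pack_for {linear O -> M} f fl.
exists f'; split; first by exists coord.
move=> x p /=; move: p; rewrite /f.
elim/divfree_span: x => [||r|a x y Qx Qy] p.
- by rewrite Omega_dfd1 -uact_X1 uactA.
- by rewrite Omega_dfd2 -uact_X2 uactA.
- rewrite Omega_dfD lact_dfD_gen GE /lpow pshift.unlock -scalerAr.
  by congr (uact (_ *: _) e); rewrite mulrC.
by rewrite !lact_linear_l uact_linear_l Qx Qy.
Qed.

End Module.

Theorem theorem2p6 (R : realType) (M : lieModType (divfree R[i])) :
  free_of_rank 1 (resU M) ->
  (exists x : divfree R[i], in_derived x /\ exists m : M, lact x m <> 0%R) ->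
  exists (l1 l2 : nonzero R[i]) (a1 a2 : R[i]),
    lieMod_iso M (Omega l1 l2 a1 a2).
Proof.
move=> /free_rank1_generator[e [coord eK cK]] nontriv.
have [l1 [l2 [a1 [a2 GE]]]] := bracket_family (lact_coef0 eK cK)
  (lact_coef_bracket eK cK) (lact_coef_nontriv cK nontriv).
by exists l1, l2, a1, a2; apply: gen_iso_Omega GE.
Qed.
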